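(* Let $\lambda\in\sigma_{ess}(H_0)$ be a semi-regular point and let $H_0$ be resonant at $\lambda$. For any regular direction $V=F^*JF$ at $H_0$ there exists a finite-rank self-adjoint operator $K$ on $\mathcal K$ such that the direction $V-F^*KF$ is not regular at $H_0$.
   Context: Let $\mathcal H,\mathcal K$ be complex Hilbert spaces and $F\colon\mathcal H\to\mathcal K$ a closed densely defined operator with trivial kernel and dense range (a rigging). Let $\mathcal A_0=\{F^*JF: J=J^*\in\mathcal B(\mathcal K)\}$; its elements are called directions. $H_0$ is a self-adjoint operator on $\mathcal H$ such that $F$ is $|H_0|^{1/2}$-compact, and $\mathcal A=H_0+\mathcal A_0$ (sums understood as form sums, which are self-adjoint). For $H\in\mathcal A$ and non-real $z$, $T_z(H)$ is the bounded (compact) operator on $\mathcal K$ given by the closure of $F(H-z)^{-1}F^*$; $T_{\lambda+i0}(H)$ is the norm limit of $T_{\lambda+iy}(H)$ as $y\to0^+$, if it exists. $H\in\mathcal A$ is regular at $\lambda\in\mathbb R$ if $T_{\lambda+i0}(H)$ exists, and resonant at $\lambda$ otherwise. $\lambda$ is semi-regular if some $H\in\mathcal A$ is regular at $\lambda$. A direction $V$ is regular at $H_0$ (with respect to $\lambda$) if $T_{\lambda+i0}(H_0+rV)$ exists for some $r\in\mathbb R$; thus $V$ is not regular if and only if the whole line $H_0+\mathbb RV$ consists of operators resonant at $\lambda$. *)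

(* Defs.v *)
From HB Require Import structures.
From mathcomp Require Import all_boot all_order all_algebra.
From mathcomp Require Import complex.
From mathcomp Require Import all_classical all_reals all_analysis.
Export numFieldNormedType.Exports.

Set Implicit Arguments.
Unset Strict Implicit.
Unset Printing Implicit Defensive.

Import Order.TTheory GRing.Theory Num.Theory.
Local Open Scope classical_set_scope.
Local Open Scope ring_scope.
Local Open Scope complex_scope.

(* The inner product is linear in its first argument. *)
HB.mixin Record isHilbert (R : realType) H of CompleteNormedModule R[i] H := {
  hdot : {dot H for (@Num.conj R[i])} ;
  hdot_norm : forall x : H, hdot x x = `|x| ^+ 2
}.

#[short(type="hilbertType")]
HB.structure Definition Hilbert (R : realType) :=
  { H of isHilbert R H & CompleteNormedModule R[i] H }.

(* Unbounded operators are represented by their graphs, so that equality of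
   operators includes equality of domains. *)
Notation oprel H K := (set (H * K)).

Section Operators.
Context {R : realType}.
Implicit Types H K L : hilbertType R.

Definition is_operator H K (G : oprel H K) :=
  [/\ G (0, 0),
      forall (a : R[i]) f g u v,
        G (f, u) -> G (g, v) -> G (a *: f + g, a *: u + v)
    & forall u, G (0, u) -> u = 0].

Definition dom H K (G : oprel H K) : set H := [set f | exists u, G (f, u)].

Definition ran H K (G : oprel H K) : set K := [set u | exists f, G (f, u)].

(* Meaningful on [dom G] only. *)
Definition app H K (G : oprel H K) (f : H) : K := xget 0 [set u | G (f, u)].

Definition graph H K (T : H -> K) : oprel H K := [set p | p.2 = T p.1].

Definition opcomp H K L (G2 : oprel K L) (G1 : oprel H K) : oprel H L :=
  [set p | exists2 v, G1 (p.1, v) & G2 (v, p.2)].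

Definition opinv H K (G : oprel H K) : oprel K H := [set p | G (p.2, p.1)].

(* A - z *)
Definition opshift H (A : oprel H H) (z : R[i]) : oprel H H :=
  [set p | A (p.1, p.2 + z *: p.1)].

Definition adj H K (G : oprel H K) : oprel K H :=
  [set p | forall f u, G (f, u) -> hdot u p.1 = hdot f p.2].

Definition selfadjoint H (A : oprel H H) :=
  [/\ is_operator A, dense (dom A) & adj A = A].

Definition nonnegative H (A : oprel H H) :=
  forall f u, A (f, u) -> 0 <= hdot u f.

(* B = A^(1/2) *)
Definition is_sqrt H (A B : oprel H H) :=
  [/\ selfadjoint B, nonnegative B & opcomp B B = A].

(* M = |A| = (A^* A)^(1/2) *)
Definition is_abs H (A M : oprel H H) := is_sqrt (opcomp (adj A) A) M.

(* S is the partial isometry of the polar decomposition A = S |A|; for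
   self-adjoint A this is sgn A, with sgn 0 = 0. *)
Definition is_sgn H (A M : oprel H H) (S : {linear H -> H}) :=
  [/\ continuous S, A = opcomp (graph S) M & forall f, A (f, 0) -> S f = 0].

Definition bounded_selfadjoint K (J : {linear K -> K}) :=
  continuous J /\ forall x y, hdot (J x) y = hdot x (J y).

Definition finite_dimensional H (E : set H) :=
  exists (n : nat) (v : 'I_n -> H), forall x, E x ->
    exists c : 'I_n -> R[i], x = \sum_(i < n) c i *: v i.

Definition finite_rank H K (T : H -> K) := finite_dimensional (range T).

Definition resolvent_set H (A : oprel H H) : set R[i] :=
  [set z | exists2 S : {linear H -> H}, continuous S &
    opinv (opshift A z) = graph S].

Definition spectrum H (A : oprel H H) : set R[i] := ~` resolvent_set A.

(* Isolated eigenvalues of finite multiplicity; meant for self-adjoint A, for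
   which the geometric and algebraic multiplicities of such points agree. *)
Definition discrete_spectrum H (A : oprel H H) : set R[i] :=
  [set z | [/\ isolated (spectrum A : set (R[i] : numFieldType)) z,
    exists2 f, f != 0 & A (f, z *: f)
    & finite_dimensional [set f | A (f, z *: f)]]].

Definition ess_spectrum H (A : oprel H H) : set R[i] :=
  spectrum A `\` discrete_spectrum A.

Definition rigging H K (F : oprel H K) :=
  [/\ is_operator F /\ closed F, dense (dom F),
      forall f, F (f, 0) -> f = 0
    & dense (ran F)].

(* F is compact as an operator from dom B, with the graph norm of B. *)
Definition relatively_compact H K (F : oprel H K) (B : oprel H H) :=
  dom B `<=` dom F /\
  precompact [set u | exists f b,
    [/\ F (f, u), B (f, b) & `|f| ^+ 2 + `|b| ^+ 2 <= 1]].

(* The direction F^* J F, as the form <J F f, F g> on dom F. *)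
Definition direction H K (F : oprel H K) (J : K -> K) : H -> H -> R[i] :=
  fun f g => hdot (J (app F f)) (app F g).

(* The form sum H0 + V, where B = |H0|^(1/2) and S = sgn H0: the form of H0 is
   <S B f, B g> on dom B, and H0 + V is the operator associated with the sum of
   the two forms on dom B. *)
Definition form_sum H (B : oprel H H) (S : H -> H) (V : H -> H -> R[i]) :
    oprel H H :=
  [set p | dom B p.1 /\ forall g, dom B g ->
    hdot (S (app B p.1)) (app B g) + V p.1 g = hdot p.2 g].

Definition affine_space H K (F : oprel H K) (B : oprel H H) (S : H -> H) :
    set (oprel H H) :=
  [set A | exists2 J : {linear K -> K}, bounded_selfadjoint J &
    A = form_sum B S (direction F J)].

(* T_z(A), as the closure of F (A - z)^-1 F^* *)
Definition sandwiched_resolvent H K (F : oprel H K) (A : oprel H H)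
    (z : R[i]) : oprel K K :=
  closure (opcomp F (opcomp (opinv (opshift A z)) (adj F))).

(* T_z(A) at z = lam + i y converges in operator norm as y -> 0+. *)
Definition regular_at H K (F : oprel H K) (lam : R) (A : oprel H H) :=
  exists2 T : {linear K -> K}, continuous T &
    forall e : R, 0 < e -> \forall y \near (0 : R)^'+,
      exists S : {linear K -> K},
        [/\ continuous S, sandwiched_resolvent F A (lam +i* y) = graph S
          & forall x, `|S x - T x| <= e%:C * `|x|].

Definition resonant_at H K (F : oprel H K) (lam : R) (A : oprel H H) :=
  ~ regular_at F lam A.

Definition semi_regular H K (F : oprel H K) (B : oprel H H) (S : H -> H)
    (lam : R) :=
  exists2 A, affine_space F B S A & regular_at F lam A.

Definition regular_direction H K (F : oprel H K) (B : oprel H H) (S : H -> H)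
    (lam : R) (V : H -> H -> R[i]) :=
  exists r : R, regular_at F lam (form_sum B S (fun f g => r%:C * V f g)).

End Operators.

(* Main.v *)
From HB Require Import structures.
Require Import Defs.
From mathcomp Require Import all_boot all_order all_algebra.
From mathcomp Require Import complex.
From mathcomp Require Import all_classical all_reals all_analysis.
From mathcomp Require Import ring lra.
Local Open Scope classical_set_scope.
Local Open Scope ring_scope.
Local Open Scope complex_scope.

Set Implicit Arguments.
Unset Strict Implicit.
Unset Printing Implicit Defensive.

Import Order.TTheory GRing.Theory Num.Theory.

(** Write [V_J] for the form [<J F f, F g>], [A_J] for the form sum of [H0]
    and [V_J], and [T_z(J)] for the sandwiched resolvent of [A_J]. The
    resolvent identity is [T_z(J1) = T_z(J2) (1 + (J2 - J1) T_z(J1))].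

    Let [A_(r J)] be regular at [lam], with boundary value [T = T_(lam + i0)].
    If [1 - r J T] had a bounded inverse [W], the resolvent identity would
    give the boundary value [T W] to [H0], which is resonant. As a norm limit
    of compact operators [T] is compact, so by the Fredholm alternative some
    [u <> 0] satisfies [u = r J T u]; put [x = T u], which is not [0].

    Because [J] is self-adjoint, [<J x, x>] is real, and this is all that is
    needed for a finite-rank self-adjoint [K0] with [K0 x = J x]: the one of
    [finite_rank_interpolation]. Now [s (J - K0)] kills [x] for every real
    [s], so [(1 + (s (J - K0) - r J) T) u = u - r J x = 0]. If
    [A_(s (J - K0))] had a boundary value [T'], the resolvent identity
    [T = T' (1 + (s (J - K0) - r J) T)] would make [x = T u] vanish. Hence the
    whole line is resonant.

    What has to be supplied is the resolvent identity together with the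
    existence and compactness of [T_z(J)] for non-real [z]. Form sums are not
    handled as operators: [form_resolvent] describes [F (A_J - z)^-1 F^*] by a
    form equation in which the right-hand side [F^* k] is read as [<k, F g>].
    There the resolvent identity is a tautology ([form_resolvent_shift]). For
    [J = 0] the equation is solved explicitly ([free_resolvent_exists]) as
    soon as the sign of [H0] is known to commute with [|H0|^(1/2)]; this rests
    on the commutation of positive operators with whatever commutes with their
    squares ([sqrt_commutes]). The general case follows from the Fredholm
    alternative ([fredholm_alternative]), and density of the domain of [F^*]
    identifies the solution with the sandwiched resolvent ([closure_graph],
    [adj_dense]).

    Norms take values in [R[i]]; [nrm] is their real part. Vector identities
    are proved by pairing both sides with an arbitrary vector ([hdot_ext]). *)

Local Notation Re := complex.Re.
Local Notation Im := complex.Im.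

(** * Orthogonal projections *)

Lemma discriminant_le (R : realType) (a b c : R) : 0 <= a -> 0 <= c ->
  (forall t : R, 0 <= a - 2 * t * b + t ^+ 2 * c) -> b ^+ 2 <= a * c.
Proof.
move=> a0 c0 h; have [c1|c1] := eqVneq c 0.
  have [->|b0] := eqVneq b 0; first by rewrite expr0n /= mulr_ge0.
  have := h ((a + 1) / (2 * b)); rewrite c1 mulr0 addr0.
  suff -> : 2 * ((a + 1) / (2 * b)) * b = a + 1 by lra.
  by field.
have cp : 0 < c by rewrite lt_def c1.
have := h (b / c).
suff -> : a - 2 * (b / c) * b + (b / c) ^+ 2 * c = (a * c - b ^+ 2) / c.
  by rewrite pmulr_lge0 ?invr_gt0// subr_ge0.
by field.
Qed.

Lemma invS_lt (R : realType) (e : R) : 0 < e ->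
  exists N : nat, forall n, (N <= n)%N -> n.+1%:R^-1 < e.
Proof.
by move=> e0; have [N _ hN] := near_infty_natSinv_lt (PosNum e0); exists N.
Qed.

Lemma le0_of_eps (R : realType) (a c : R) :
  (forall e : R, 0 < e -> a <= c * e) -> a <= 0.
Proof.
move=> h; case: (lerP a 0) => // a0.
have c0 : 0 < c by have := h 1 ltr01; lra.
have := h (a / (2 * c)); have -> : c * (a / (2 * c)) = a / 2 by field; lra.
by move=> /(_ (divr_gt0 a0 (mulr_gt0 _ c0))); lra.
Qed.

Lemma sqrD_le (R : realType) (a b c : R) :
  a ^+ 2 <= c -> b ^+ 2 <= c -> (a + b) ^+ 2 <= 4 * c.
Proof. by move=> ha hb; have := sqr_ge0 (a - b); rewrite sqrrB sqrrD; lra. Qed.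

Section Projection.
Context {R : realType} {V : lmodType R[i]} (d : V -> V -> R[i]).
Hypothesis dP : forall a x y z, d (a *: x + y) z = a * d x z + d y z.
Hypothesis dC : forall x y, d y x = conjc (d x y).
Hypothesis d_ge0 : forall x, 0 <= Re (d x x).
Let q x := Re (d x x).
Let r x y := Re (d x y).

Let rC x y : r x y = r y x.
Proof. by rewrite /r [d x y]dC; case: (d y x). Qed.

Let d0l z : d 0 z = 0.
Proof.
have := dP 1 0 0 z; rewrite scaler0 addr0 mul1r.
by move=> /eqP; rewrite -subr_eq subrr eq_sym => /eqP.
Qed.

Let rD x y z : r (x + y) z = r x z + r y z.
Proof.
by rewrite /r -[x]scale1r dP mul1r scale1r; case: (d x z); case: (d y z).
Qed.

Let rZ (t : R) x z : r (t%:C *: x) z = t * r x z.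
Proof.
rewrite /r -[_ *: x]addr0 dP d0l.
by case: (d x z) => u v /=; rewrite addr0 mul0r subr0.
Qed.

Let rN x z : r (- x) z = - r x z.
Proof.
rewrite -[- x]scaleN1r (_ : -1 = (-1)%:C) ?rZ ?mulN1r //.
by rewrite rmorphN rmorph1.
Qed.

Let q_line x e t : q (x - t%:C *: e) = q x - 2 * t * r x e + t ^+ 2 * q e.
Proof.
rewrite /q -!/(r _ _) rD rN rZ ![r _ (x - _)]rC !rD !rN !rZ (rC e x); ring.
Qed.

Let r_le x e (b : R) : b <= q x -> (forall t : R, b <= q (x - t%:C *: e)) ->
  r x e ^+ 2 <= (q x - b) * q e.
Proof.
move=> bx h; apply: discriminant_le => [||t]; [by rewrite subr_ge0|exact: d_ge0|].
by have := h t; rewrite q_line; lra.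
Qed.

(** The projection is the limit of a minimising sequence for the distance from
    [x] to [E]; the parallelogram law makes that sequence Cauchy. Only a
    semi-inner product and the completeness of [E] itself are used, so that the
    graph of a closed operator is covered as well. *)
Lemma orthogonal_projection (E : set V) (x : V) :
  E 0 -> (forall a e f, E e -> E f -> E (a *: e + f)) ->
  (forall s : nat -> V, (forall n, E (s n)) ->
     (forall eps : R, 0 < eps -> exists N : nat, forall m n, (N <= m)%N -> (N <= n)%N ->
        Re (d (s m - s n) (s m - s n)) < eps) ->
     exists2 l, E l & forall eps : R, 0 < eps -> exists N : nat, forall n, (N <= n)%N ->
        Re (d (s n - l) (s n - l)) < eps) ->
  exists2 p, E p & forall e, E e -> d (x - p) e = 0.
Proof.
move=> E0 EP Ecomp.
have EZ a e : E e -> E (a *: e) by move=> Ee; rewrite -[_ *: e]addr0; exact: EP.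
have ED e f : E e -> E f -> E (e + f).
  by move=> Ee Ef; rewrite -[e]scale1r; exact: EP.
pose D := [set q (x - e) | e in E].
have Dlb : has_lbound D by exists 0 => _ [e _ <-]; exact: d_ge0.
have Dinf : has_inf D by split=> //; exists (q (x - 0)); exists 0.
have /choice[s sP] : forall n : nat, exists e,
    E e /\ q (x - e) < inf D + n.+1%:R^-1.
  move=> n; have np : 0 < n.+1%:R^-1 :> R by rewrite invr_gt0.
  by have [_ [e Ee <-] he] := inf_adherent np Dinf; exists e.
have Es n : E (s n) by case: (sP n).
have sD n : q (x - s n) < inf D + n.+1%:R^-1 by case: (sP n).
have Dle e : E e -> inf D <= q (x - e) by move=> Ee; apply: ge_inf => //; exists e.
have [l El sl] : exists2 l, E l & forall eps : R, 0 < eps -> exists N : nat, forall n,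
    (N <= n)%N -> q (s n - l) < eps.
  apply: Ecomp => // eps eps0.
  have e4 : 0 < eps / 4 by lra.
  have [N hN] := invS_lt e4; exists N => m n Nm Nn.
  have hm := sD m; have hn := sD n; have em := hN _ Nm; have en := hN _ Nn.
  have := Dle (2^-1 *: (s m + s n)) (EZ _ _ (ED _ _ (Es m) (Es n))).
  have -> : (2^-1 : R[i]) = (2^-1 : R)%:C by rewrite fmorphV rmorphMn.
  rewrite q_line /q -!/(r _ _) in hm hn *.
  move: hm hn; rewrite !(rD, rN, rC _ (_ + _), rC _ (- _)) (rC (s n) (s m)).
  rewrite (rC (s n) x) (rC (s m) x).
  move: em en; move: (inf D) (m.+1%:R^-1) (n.+1%:R^-1) (r x x) (r x (s m)) (r x (s n)).
  move: (r (s m) (s m)) (r (s m) (s n)) (r (s n) (s n)); clear.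
  by move=> mm mn nn I im jn xx xm xn *; lra.
exists l => //.
suff rl e : E e -> r (x - l) e = 0.
  move=> e Ee; have h1 := rl _ Ee; have := rl _ (EZ 'i%C _ Ee).
  rewrite rC /r -[_ *: e]addr0 dP d0l addr0 [d e _]dC.
  by move: h1; rewrite /r; case: (d (x - l) e) => u v /= -> /eqP; simpc => /eqP ->.
move=> Ee; apply/eqP; rewrite -sqrf_eq0 eq_le sqr_ge0 andbT.
apply: (@le0_of_eps _ _ (4 * q e)) => eps eps0.
have [N1 hN1] := sl _ eps0; have [N2 hN2] := invS_lt eps0.
pose n := maxn N1 N2; have h1 := hN1 n (leq_maxl _ _); have h2 := hN2 n (leq_maxr _ _).
have h3 : r (x - s n) e ^+ 2 <= (q (x - s n) - inf D) * q e.
  apply: r_le => [|t]; first exact: Dle.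
  by rewrite -addrA -opprD; apply: Dle; apply: ED => //; exact: EZ.
have h4 : r (s n - l) e ^+ 2 <= q (s n - l) * q e.
  by rewrite -[q (s n - l)]subr0; apply: r_le => [|t]; exact: d_ge0.
have -> : r (x - l) e = r (x - s n) e + r (s n - l) e.
  by rewrite -rD addrA subrK.
have q0 : 0 <= q e := d_ge0 e.
have h5 : (q (x - s n) - inf D) * q e <= eps * q e.
  apply: ler_wpM2r => //; rewrite lerBlDl; apply/ltW/(lt_trans (sD n)).
  by rewrite ltrD2l.
have h6 : q (s n - l) * q e <= eps * q e by apply: ler_wpM2r => //; exact: ltW.
rewrite -mulrA [q e * eps]mulrC.
exact: sqrD_le (le_trans h3 h5) (le_trans h4 h6).
Qed.
End Projection.

(** * Hilbert spaces *)

Section HilbertBasics.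
Context {R : realType}.
Implicit Types H K L : hilbertType R.

Definition nrm H (x : H) : R := Re `|x|.

Lemma normE H (x : H) : `|x| = (nrm x)%:C.
Proof. by rewrite RRe_real// normr_real. Qed.

Lemma hdotDl H (x y z : H) : hdot (x + y) z = hdot x z + hdot y z.
Proof. exact: linearDl. Qed.
Lemma hdotNl H (x z : H) : hdot (- x) z = - hdot x z.
Proof. exact: linearNl. Qed.
Lemma hdotBl H (x y z : H) : hdot (x - y) z = hdot x z - hdot y z.
Proof. by rewrite hdotDl hdotNl. Qed.
Lemma hdotZl H a (x z : H) : hdot (a *: x) z = a * hdot x z.
Proof. exact: linearZl_LR. Qed.
Lemma hdotDr H (x y z : H) : hdot z (x + y) = hdot z x + hdot z y.
Proof. exact: linearDr. Qed.
Lemma hdotNr H (x z : H) : hdot z (- x) = - hdot z x.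
Proof. exact: linearNr. Qed.
Lemma hdotBr H (x y z : H) : hdot z (x - y) = hdot z x - hdot z y.
Proof. by rewrite hdotDr hdotNr. Qed.
Lemma hdotZr H a (x z : H) : hdot z (a *: x) = conjc a * hdot z x.
Proof. exact: linearZr_LR. Qed.
Lemma hdot0l H (z : H) : hdot 0 z = 0.
Proof. by rewrite -(scale0r 0) hdotZl mul0r. Qed.
Lemma hdot0r H (z : H) : hdot z 0 = 0.
Proof. by rewrite -(scale0r 0) hdotZr conjc0 mul0r. Qed.
Definition hdotE := (hdotDl, hdotNl, hdotZl, hdotDr, hdotNr, hdotZr, @hdot0l, @hdot0r).

Lemma hdotC H (x y : H) : hdot y x = conjc (hdot x y).
Proof. by rewrite (hermC hdot) /= expr0 mul1r. Qed.

Lemma hdotxx H (x : H) : hdot x x = (nrm x ^+ 2)%:C.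
Proof. by rewrite hdot_norm normE rmorphXn. Qed.

Lemma nrm_sqr H (x : H) : nrm x ^+ 2 = Re (hdot x x).
Proof. by rewrite hdotxx. Qed.

Lemma nrm_ge0 H (x : H) : 0 <= nrm x.
Proof. by rewrite -ler0c -normE. Qed.

Lemma nrm0 H : nrm (0 : H) = 0.
Proof. by rewrite /nrm normr0. Qed.

Lemma nrm_eq0 H (x : H) : nrm x = 0 -> x = 0.
Proof. by move=> h; apply/eqP; rewrite -normr_eq0 normE h. Qed.

Lemma nrmD H (x y : H) : nrm (x + y) <= nrm x + nrm y.
Proof. by rewrite -lecR rmorphD /= -!normE ler_normD. Qed.

Lemma nrmN H (x : H) : nrm (- x) = nrm x.
Proof. by rewrite /nrm normrN. Qed.

Lemma nrmBC H (x y : H) : nrm (x - y) = nrm (y - x).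
Proof. by rewrite -nrmN opprB. Qed.

Lemma nrm_triangle H (y x z : H) : nrm (x - z) <= nrm (x - y) + nrm (y - z).
Proof. by rewrite (le_trans _ (nrmD _ _))// addrA subrK. Qed.

Lemma nrmZ H a (x : H) : nrm (a *: x) = Re `|a| * nrm x.
Proof.
have aE : `|a| = (Re `|a|)%:C by rewrite RRe_real// normr_real.
by apply: complexI; rewrite -normE normrZ rmorphM /= -normE -aE.
Qed.

Lemma nrmZr H (t : R) (x : H) : nrm (t%:C *: x) = `|t| * nrm x.
Proof. by rewrite nrmZ normc_def /= expr0n addr0 sqrtr_sqr. Qed.

Lemma nrm_i H (x : H) : nrm ('i%C *: x) = nrm x.
Proof. by rewrite nrmZ normc_def /= expr0n add0r expr1n sqrtr1 mul1r. Qed.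

Lemma nrm_gt0 H (x : H) : x <> 0 -> 0 < nrm x.
Proof. by move=> x0; rewrite lt_def nrm_ge0 andbT; apply/eqP => /nrm_eq0. Qed.

Lemma hdot_ext H (x y : H) : (forall v, hdot x v = hdot y v) -> x = y.
Proof.
move=> h; apply/subr0_eq/nrm_eq0/eqP; rewrite -sqrf_eq0 nrm_sqr.
by rewrite hdotBl h subrr.
Qed.

Lemma ReD (a b : R[i]) : Re (a + b) = Re a + Re b.
Proof. by case: a; case: b. Qed.

Lemma ReN (a : R[i]) : Re (- a) = - Re a.
Proof. by case: a. Qed.

Lemma Re_hdotC H (x y : H) : Re (hdot x y) = Re (hdot y x).
Proof. by rewrite (hdotC y); case: (hdot y x). Qed.

Lemma nrmD_sqr H (x y : H) :
  nrm (x + y) ^+ 2 = nrm x ^+ 2 + 2 * Re (hdot x y) + nrm y ^+ 2.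
Proof. by rewrite !nrm_sqr !hdotE !ReD (Re_hdotC y x); ring. Qed.

Lemma nrmB_sqr H (x y : H) :
  nrm (x - y) ^+ 2 = nrm x ^+ 2 - 2 * Re (hdot x y) + nrm y ^+ 2.
Proof. by rewrite nrmD_sqr nrmN hdotNr ReN; ring. Qed.

Lemma Re_hdot_le H (x y : H) : Re (hdot x y) <= nrm x * nrm y.
Proof.
apply: (le_trans (ler_norm _)).
rewrite -ler_sqr ?nnegrE ?mulr_ge0 ?nrm_ge0// real_normK ?num_real// exprMn.
apply: discriminant_le => [||t]; rewrite ?sqr_ge0//.
have := sqr_ge0 (nrm (x - t%:C *: y)); rewrite nrm_sqr !hdotE.
rewrite (hdotC x y) !hdotxx; case: (hdot x y) => a b /=.
by move: (nrm x) (nrm y) => X Y; lra.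
Qed.

Lemma Im_hdot_le H (x y : H) : Im (hdot x y) <= nrm x * nrm y.
Proof.
have := Re_hdot_le x ('i%C *: y); rewrite nrm_i hdotZr.
by case: (hdot x y) => a b /=; rewrite !mul0r mulN1r opprK add0r.
Qed.

Definition cvgs H (x : nat -> H) (l : H) :=
  forall e : R, 0 < e -> exists N : nat, forall n, (N <= n)%N -> nrm (x n - l) < e.

Lemma cauchy_cvgs H (x : nat -> H) :
  (forall e : R, 0 < e -> exists N : nat, forall m n, (N <= m)%N -> (N <= n)%N ->
     nrm (x m - x n) < e) -> exists l, cvgs x l.
Proof.
move=> hx; have /cauchy_cvg/cvg_ex[l xl] : cauchy (x @ \oo).
  apply/cauchy_ballP => e e0.
  have eE : e = (Re e)%:C by rewrite RRe_real// gtr0_real.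
  have e1 : 0 < Re e by rewrite -ltcR -eE.
  have [N hN] := hx (Re e) e1.
  rewrite near_map2; near=> m n; rewrite /= -ball_normE /ball_ /= eE normE ltcR.
  by apply: hN; [near: m|near: n]; exists N.
exists l => e e0; have := xl; move=> /cvgrPdist_lt /(_ e%:C).
rewrite ltcR => /(_ e0) [N _ hN]; exists N => n /hN.
by rewrite /= normE ltcR nrmBC.
Unshelve. all: by end_near. Qed.

Lemma cvgs_cauchy H (x : nat -> H) l : cvgs x l -> forall e : R, 0 < e ->
  exists N : nat, forall m n, (N <= m)%N -> (N <= n)%N -> nrm (x m - x n) < e.
Proof.
move=> xl e e0; have [N hN] := xl _ (divr_gt0 e0 (ltr0n R 2)).
exists N => m n /hN hm /hN hn; have := nrm_triangle l (x m) (x n).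
by move: hn; rewrite nrmBC; lra.
Qed.

Lemma cvgs_unique H (x : nat -> H) l l' : cvgs x l -> cvgs x l' -> l = l'.
Proof.
move=> xl xl'; apply/subr0_eq/nrm_eq0/eqP; rewrite eq_le nrm_ge0 andbT.
apply: (@le0_of_eps _ _ 2) => e e0.
have [N hN] := xl _ e0; have [N' hN'] := xl' _ e0.
have := hN (maxn N N') (leq_maxl _ _); have := hN' (maxn N N') (leq_maxr _ _).
by have := nrm_triangle (x (maxn N N')) l l'; rewrite (nrmBC l (x _)); lra.
Qed.

Lemma cvgs_hdot_eq H K (x : nat -> H) l y (x' : nat -> K) l' y' :
  cvgs x l -> cvgs x' l' -> (forall n, hdot (x n) y = hdot (x' n) y') ->
  hdot l y = hdot l' y'.
Proof.
move=> xl xl' xx'; set w := hdot l y - hdot l' y'.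
suff w0 : Re (conjc w * w) <= 0.
  apply/eqP; rewrite -subr_eq0 -/w; case: w w0 => a b /= h.
  have [a0 b0] : a ^+ 2 = 0 /\ b ^+ 2 = 0.
    by have := sqr_ge0 a; have := sqr_ge0 b; rewrite !expr2; split; lra.
  by move/eqP: a0; move/eqP: b0; rewrite !sqrf_eq0 eq_complex /= => -> ->.
apply: (@le0_of_eps _ _ (nrm (w *: y) + nrm (w *: y'))) => e e0.
have [N hN] := xl _ e0; have [M hM] := xl' _ e0; pose n := maxn N M.
have /ltW hn := hN n (leq_maxl _ _); have /ltW hm := hM n (leq_maxr _ _).
have -> : conjc w * w = hdot (l - x n) (w *: y) + hdot (x' n - l') (w *: y').
  by rewrite !hdotZr !hdotBl xx' -mulrDr addrA subrK.
rewrite ReD mulrDl lerD// (le_trans (Re_hdot_le _ _))// mulrC.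
  by rewrite ler_wpM2l ?nrm_ge0// nrmBC.
by rewrite ler_wpM2l ?nrm_ge0.
Qed.

Lemma closed_projection H (D : set H) x : D 0 ->
  (forall a e f, D e -> D f -> D (a *: e + f)) ->
  (forall s l, (forall n, D (s n)) -> cvgs s l -> D l) ->
  exists2 p, D p & forall e, D e -> hdot (x - p) e = 0.
Proof.
move=> D0 DP Dcl.
apply: (@orthogonal_projection R H (@hdot R H)) => //.
- by move=> a u v w; rewrite hdotDl hdotZl.
- exact: hdotC.
- by move=> u; rewrite -nrm_sqr sqr_ge0.
- move=> s Ds sc; have [|l sl] := @cauchy_cvgs H s.
    move=> e e0; have [N hN] := sc _ (exprn_gt0 2 e0); exists N => m n Nm Nn.
    by have := hN _ _ Nm Nn; rewrite -nrm_sqr ltr_pXn2r ?nnegrE ?nrm_ge0// ltW.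
  exists l; first exact: Dcl sl.
  move=> e e0; have [|N hN] := sl (Num.sqrt e); first by rewrite sqrtr_gt0.
  exists N => n /hN; rewrite -nrm_sqr => h.
  by rewrite -[e]sqr_sqrtr ?ltW// ltr_pXn2r ?nnegrE ?nrm_ge0 ?sqrtr_ge0.
Qed.

Lemma dense_subspace H (D : set H) : D 0 ->
  (forall a e f, D e -> D f -> D (a *: e + f)) ->
  (forall x l, (forall n, D (x n)) -> cvgs x l -> D l) ->
  (forall v, (forall e, D e -> hdot e v = 0) -> v = 0) ->
  forall x, D x.
Proof.
move=> D0 DP Dcl Dperp x; have [p Dp hp] := closed_projection x D0 DP Dcl.
have /subr0_eq -> // : x - p = 0.
by apply: Dperp => e /hp h; rewrite hdotC h conjc0.
Qed.

End HilbertBasics.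

(** * Bounded linear maps and adjoints *)

Section BoundedLinear.
Context {R : realType}.
Implicit Types H K L : hilbertType R.

Definition bounded_linear H K (T : H -> K) :=
  (forall a x y, T (a *: x + y) = a *: T x + T y) /\
  exists2 c, 0 <= c & forall x, nrm (T x) <= c * nrm x.

Section Theory.
Context {H K : hilbertType R} {T : H -> K}.
Hypothesis bT : bounded_linear T.

Lemma blD x y : T (x + y) = T x + T y.
Proof. by case: bT => TP _; rewrite -{1}[x]scale1r TP scale1r. Qed.

Lemma bl0 : T 0 = 0.
Proof. by have /eqP := blD 0 0; rewrite addr0 -subr_eq subrr => /eqP. Qed.

Lemma blZ a x : T (a *: x) = a *: T x.
Proof. by case: bT => TP _; rewrite -[_ *: x]addr0 TP bl0 addr0. Qed.

Lemma blN x : T (- x) = - T x.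
Proof. by rewrite -scaleN1r blZ scaleN1r. Qed.

Lemma blB x y : T (x - y) = T x - T y.
Proof. by rewrite blD blN. Qed.

Lemma bl_cvgs x l : cvgs x l -> cvgs (fun n => T (x n)) (T l).
Proof.
case: (bT) => _ [c c0 hc] xl e e0; have c1 : 0 < c + 1 by lra.
have [N hN] := xl _ (divr_gt0 e0 c1); exists N => n /hN h.
rewrite -blB; apply: (le_lt_trans (hc _)); move: h; rewrite ltr_pdivlMr// => h.
by apply: le_lt_trans h; rewrite mulrC; apply: ler_wpM2l; [exact: nrm_ge0|lra].
Qed.

Lemma linear_of_bounded : exists S : {linear H -> K}, S =1 T.
Proof.
have lT : linear T by case: bT.
pose S := HB.pack_for {linear H -> K} T (GRing.isLinear.Build _ _ _ _ T lT).
by exists S.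
Qed.

End Theory.

Lemma bl_ext H K (S T : H -> K) : S =1 T -> bounded_linear T -> bounded_linear S.
Proof. by move=> /funext ->. Qed.

Lemma bl_id H : bounded_linear (@id H).
Proof. by split=> //; exists 1 => // x; rewrite mul1r. Qed.

Lemma bl_comp H K L (S : K -> L) (T : H -> K) :
  bounded_linear S -> bounded_linear T -> bounded_linear (fun x => S (T x)).
Proof.
move=> bS bT; split=> [a x y|]; first by rewrite (blD bT) (blZ bT) (blD bS) (blZ bS).
case: bS bT => _ [c c0 hc] [_ [d d0 hd]]; exists (c * d) => [|x].
  exact: mulr_ge0.
by rewrite (le_trans (hc _))// -mulrA ler_wpM2l.
Qed.

Lemma bl_add H K (S T : H -> K) :
  bounded_linear S -> bounded_linear T -> bounded_linear (fun x => S x + T x).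
Proof.
move=> [SP [c c0 hc]] [TP [d d0 hd]]; split=> [a x y|].
  by rewrite SP TP scalerDr addrACA.
exists (c + d) => [|x]; first exact: addr_ge0.
by rewrite (le_trans (nrmD _ _))// mulrDl lerD.
Qed.

Lemma bl_scale H K a (T : H -> K) :
  bounded_linear T -> bounded_linear (fun x => a *: T x).
Proof.
move=> [TP [d d0 hd]]; split=> [b x y|].
  by rewrite TP scalerDr !scalerA mulrC.
have a0 : 0 <= Re `|a| by rewrite -ler0c RRe_real ?normr_ge0// normr_real.
exists (Re `|a| * d) => [|x]; first exact: mulr_ge0.
by rewrite nrmZ -mulrA ler_wpM2l.
Qed.

Lemma bl_opp H K (T : H -> K) :
  bounded_linear T -> bounded_linear (fun x => - T x).
Proof.
by move=> /(bl_scale (-1)); apply: bl_ext => x; rewrite scaleN1r.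
Qed.

Lemma bl_sub H K (S T : H -> K) :
  bounded_linear S -> bounded_linear T -> bounded_linear (fun x => S x - T x).
Proof. by move=> bS bT; exact: (bl_add bS (bl_opp bT)). Qed.

Lemma bl_eq_dense H K (S T : H -> K) : bounded_linear S -> bounded_linear T ->
  (forall v, (forall e, S e = T e -> hdot e v = 0) -> v = 0) -> S =1 T.
Proof.
move=> bS bT hST; apply: (@dense_subspace _ _ [set h | S h = T h]) => //=.
- by rewrite (bl0 bS) (bl0 bT).
- by move=> a e f he hf; rewrite (blD bS) (blZ bS) (blD bT) (blZ bT) he hf.
- move=> x l hx xl; apply: (cvgs_unique (bl_cvgs bS xl)).
  by under eq_fun do rewrite hx; exact: bl_cvgs.
Qed.

Lemma bounded_of_continuous H K (T : {linear H -> K}) :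
  continuous T -> bounded_linear T.
Proof.
move=> /linear_bounded_continuous/linear_boundedP hT.
split=> [a x y|]; first exact: linearP.
have [c c0 hc] := pinfty_ex_gt0 hT.
have cE : c = (Re c)%:C by rewrite RRe_real// gtr0_real.
exists (Re c) => [|x]; first by rewrite -ler0c -cE ltW.
by rewrite -lecR -normE rmorphM /= -normE -cE.
Qed.

Lemma continuous_of_bounded H K (T : {linear H -> K}) :
  bounded_linear T -> continuous T.
Proof.
move=> [_ [c c0 hc]]; apply/linear_bounded_continuous/linear_boundedP.
near=> r => x; have rc : c%:C <= r by near: r; apply: nbhs_pinfty_ge; rewrite complex_real.
rewrite (@le_trans _ _ (c%:C * `|x|))//; last by rewrite ler_wpM2r.
by rewrite !normE -rmorphM lecR.
Unshelve. all: by end_near. Qed.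

(** Riesz representation: off the kernel of a bounded functional there is,
    up to scaling, only one direction orthogonal to it. *)
Lemma riesz H (p : H -> R[i]) :
  (forall a x y, p (a *: x + y) = a * p x + p y) ->
  (exists2 c, 0 <= c & forall x, Re `|p x| <= c * nrm x) ->
  exists v, forall x, p x = hdot x v.
Proof.
move=> pP [c c0 hc].
have pD x y : p (x + y) = p x + p y by rewrite -{1}[x]scale1r pP mul1r.
have p0 : p 0 = 0 by have /eqP := pD 0 0; rewrite addr0 -subr_eq subrr => /eqP.
have pZ a x : p (a *: x) = a * p x by rewrite -[_ *: x]addr0 pP p0 addr0.
have pB x y : p (x - y) = p x - p y by rewrite pD -scaleN1r pZ mulN1r.
have kerP a e f : p e = 0 -> p f = 0 -> p (a *: e + f) = 0.
  by move=> he hf; rewrite pP he hf mulr0 addr0.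
have ker_closed x l : (forall n, p (x n) = 0) -> cvgs x l -> p l = 0.
  move=> hx xl; apply/eqP; rewrite -normr_le0.
  rewrite -[`|p l|]RRe_real ?normr_real// lecR.
  apply: (@le0_of_eps _ _ c) => e e0; have [N hN] := xl _ e0.
  have := hc (l - x N); rewrite pB hx subr0 => /le_trans; apply.
  by rewrite ler_wpM2l// ltW// nrmBC hN.
have [h|] := pselect (forall v, (forall e, p e = 0 -> hdot e v = 0) -> v = 0).
  by exists 0 => x; rewrite hdot0r; apply: (@dense_subspace _ _ [set x | p x = 0]).
move=> /existsNP[v /not_implyP[hv v0]]; have nv := nrm_gt0 v0.
have vv : hdot v v != 0 by rewrite hdotxx eq_complex /= eqxx andbT sqrf_eq0 gt_eqF.
exists (conjc (p v / hdot v v) *: v) => x; rewrite hdotZr conjcK.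
have /hv : p (p v *: x - p x *: v) = 0 by rewrite pB !pZ mulrC subrr.
rewrite hdotBl !hdotZl => /eqP; rewrite subr_eq0 => /eqP h.
by rewrite mulrAC h mulfK.
Qed.

Lemma norm_hdot_le H (x y : H) : Re `|hdot x y| <= nrm x * nrm y.
Proof.
have [->|w0] := eqVneq (hdot x y) 0; first by rewrite normr0 mulr_ge0 ?nrm_ge0.
set w := hdot x y in w0 *; pose a := conjc w / `|w|.
have nw : `|w| != 0 by rewrite normr_eq0.
have na : `|a| = 1 by rewrite normrM normrV ?unitfE// normr_id normcJ mulfV.
have -> : `|w| = hdot (a *: x) y.
  by rewrite hdotZl -/w mulrAC [_ * w]mulrC -sqr_normc expr2 mulfK.
by rewrite (le_trans (Re_hdot_le _ _))// nrmZ na /= mul1r.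
Qed.

Lemma bl_rank1 H K (x : H) (b : K) : bounded_linear (fun y => hdot y x *: b).
Proof.
split=> [a y z|]; first by rewrite hdotDl hdotZl scalerDl scalerA.
exists (nrm x * nrm b) => [|y]; first by rewrite mulr_ge0 ?nrm_ge0.
by rewrite nrmZ mulrAC ler_wpM2r ?nrm_ge0// mulrC norm_hdot_le.
Qed.

Lemma adjoint_exists H K (T : H -> K) : bounded_linear T ->
  exists2 T' : K -> H, bounded_linear T' & forall k h, hdot k (T h) = hdot (T' k) h.
Proof.
move=> bT; case: (bT) => _ [c c0 hc].
have /choice[T' hT'] : forall k, exists v, forall h, hdot (T h) k = hdot h v.
  move=> k; apply: riesz => [a x y|].
    by rewrite (blD bT) (blZ bT) hdotDl hdotZl.
  exists (nrm k * c) => [|x]; first by rewrite mulr_ge0 ?nrm_ge0.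
  by rewrite (le_trans (norm_hdot_le _ _))// mulrC -mulrA ler_wpM2l ?nrm_ge0.
have hT k h : hdot k (T h) = hdot (T' k) h by rewrite hdotC hT' -hdotC.
exists T' => //; split=> [a x y|].
  by apply: hdot_ext => h; rewrite -hT !hdotDl !hdotZl !hT.
exists c => // k; have [->|/eqP k0] := eqVneq (T' k) 0.
  by rewrite nrm0 mulr_ge0 ?nrm_ge0.
have np := nrm_gt0 k0; rewrite -(ler_pM2r np) -expr2 nrm_sqr -hT.
rewrite (le_trans (Re_hdot_le _ _))// -mulrA mulrCA ler_wpM2l ?nrm_ge0//.
Qed.

End BoundedLinear.

(** * Resolvents of self-adjoint operators *)

Section SelfAdjoint.
Context {R : realType}.
Implicit Types H K L : hilbertType R.

Lemma cvgsD H (x y : nat -> H) l m :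
  cvgs x l -> cvgs y m -> cvgs (fun n => x n + y n) (l + m).
Proof.
move=> xl ym e e0; have e2 : 0 < e / 2 by lra.
have [N hN] := xl _ e2; have [M hM] := ym _ e2; exists (maxn N M) => n.
rewrite geq_max => /andP[/hN h1 /hM h2].
by have := nrmD (x n - l) (y n - m); rewrite addrACA -opprD; lra.
Qed.

Lemma cvgsZ H a (x : nat -> H) l : cvgs x l -> cvgs (fun n => a *: x n) (a *: l).
Proof. exact: (bl_cvgs (bl_scale a (@bl_id _ H))). Qed.

Definition is_resolvent H (A : oprel H H) (z : R[i]) (Rz : H -> H) :=
  [/\ bounded_linear Rz, forall h, A (Rz h, h + z *: Rz h)
    & forall f u, A (f, u) -> Rz (u - z *: f) = f].

Section Theory.
Context {H : hilbertType R} {A : oprel H H}.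
Hypothesis sA : selfadjoint A.

Lemma sa_lin a f g u v : A (f, u) -> A (g, v) -> A (a *: f + g, a *: u + v).
Proof. by case: sA => -[_ h _] _ _; exact: h. Qed.

Lemma sa_zero : A (0, 0).
Proof. by case: sA => -[]. Qed.

Lemma sa_scale a f u : A (f, u) -> A (a *: f, a *: u).
Proof. by move=> /(@sa_lin a _ _ _ _) /(_ sa_zero); rewrite !addr0. Qed.

Lemma sa_add f g u v : A (f, u) -> A (g, v) -> A (f + g, u + v).
Proof. by move=> /(@sa_lin 1 _ _ _ _) h /h; rewrite !scale1r. Qed.

Lemma sa_adj k h : (forall f u, A (f, u) -> hdot u k = hdot f h) -> A (k, h).
Proof. by case: sA => _ _ {2}<-. Qed.

Lemma sa_dom_dense v : (forall f u, A (f, u) -> hdot f v = 0) -> v = 0.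
Proof.
move=> h; case: (sA) => -[_ _ h0] _ _; apply: h0; apply: sa_adj => f u /h ->.
by rewrite hdot0r.
Qed.

Lemma sa_ran_dense v : (forall f u, A (f, u) -> hdot u v = 0) -> A (v, 0).
Proof. by move=> h; apply: sa_adj => f u /h ->; rewrite hdot0r. Qed.

Lemma sa_sub f g u v : A (f, u) -> A (g, v) -> A (f - g, u - v).
Proof.
by move=> Af /(sa_scale (-1)) Ag; have := sa_add Af Ag; rewrite !scaleN1r.
Qed.

Lemma sa_fun f u v : A (f, u) -> A (f, v) -> u = v.
Proof.
move=> Au Av; have := sa_sub Au Av; rewrite subrr.
by case: sA => -[_ _ h] _ _ /h /subr0_eq.
Qed.

Lemma sa_sym f u g v : A (f, u) -> A (g, v) -> hdot u g = hdot f v.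
Proof. by move=> Af Ag; case: sA => _ _ sAA; move: Ag; rewrite -sAA => /(_ _ _ Af). Qed.

Lemma sa_closed (f u : nat -> H) l m :
  (forall n, A (f n, u n)) -> cvgs f l -> cvgs u m -> A (l, m).
Proof.
move=> Afu fl um; apply: sa_adj => g v Ag; rewrite hdotC [RHS]hdotC; congr conjc.
by apply: (cvgs_hdot_eq fl um) => n; rewrite (sa_sym (Afu n) Ag).
Qed.

Lemma sa_Im f u : A (f, u) -> Im (hdot u f) = 0.
Proof.
move=> Af; have := sa_sym Af Af; rewrite (hdotC u f).
by case: (hdot u f) => a b /= [] ; lra.
Qed.

Lemma sa_bound f u z : A (f, u) -> `|Im z| * nrm f <= nrm (u - z *: f).
Proof.
move=> Af; have [->|/eqP f0] := eqVneq f 0.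
  by rewrite nrm0 mulr0 nrm_ge0.
have np := nrm_gt0 f0; rewrite -(ler_pM2r np) -mulrA -expr2.
have h1 : Im (hdot (u - z *: f) f) = - (Im z * nrm f ^+ 2).
  rewrite hdotBl hdotZl hdotxx; have := sa_Im Af.
  by case: (hdot u f) => a b /= ->; case: z => c d /=; rewrite mulr0 !add0r.
have h2 := Im_hdot_le (u - z *: f) f.
have := Im_hdot_le (- (u - z *: f)) f; rewrite nrmN hdotNl.
have -> (w : R[i]) : Im (- w) = - Im w by case: w.
have := sqr_ge0 (nrm f); move: h2; rewrite h1.
by case: (ger0P (Im z)) => ?; lra.
Qed.

(** The range of [A - z] is closed because [A - z] is bounded below, and
    its orthogonal complement would consist of eigenvectors of [A] for the
    non-real eigenvalue [z^*]. *)
Lemma resolvent_exists (z : R[i]) : Im z != 0 -> exists Rz, is_resolvent A z Rz.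
Proof.
move=> z0; have zp : 0 < `|Im z| by rewrite normr_gt0.
pose D := [set h | exists f, A (f, h + z *: f)].
have Dx : forall x, D x.
  apply: dense_subspace.
  - by exists 0; rewrite scaler0 add0r; exact: sa_zero.
  - move=> a e f [e' he] [f' hf]; exists (a *: e' + f').
    have := sa_lin a he hf.
    by rewrite !scalerDr !scalerA [a * z]mulrC addrACA.
  - move=> x l /choice[f hf] xl.
    have [|m fm] := @cauchy_cvgs _ _ f.
      move=> e e0; have [N hN] := cvgs_cauchy xl (mulr_gt0 e0 zp).
      exists N => p q Np Nq; have := hN _ _ Np Nq.
      have := sa_bound z (sa_sub (hf p) (hf q)).
      have -> : x p + z *: f p - (x q + z *: f q) - z *: (f p - f q) = x p - x q.
        by apply: hdot_ext => v; rewrite !hdotE; ring.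
      by move=> /le_lt_trans h /h; rewrite mulrC ltr_pM2r.
    exists m; apply: (sa_closed hf fm); apply: cvgsD => //; exact: cvgsZ.
  - move=> v hv; have Av : A (v, conjc z *: v).
      apply: sa_adj => f u Af; have := hv (u - z *: f).
      rewrite hdotBl hdotZl hdotZr conjcK => h; apply/subr0_eq/h.
      by exists f; rewrite subrK.
    have := sa_Im Av; rewrite hdotZl hdotxx; case: (z) z0 => c d /= d0.
    move=> /eqP; rewrite mulr0 add0r mulNr oppr_eq0 mulf_eq0 (negPf d0) sqrf_eq0.
    by move=> /eqP/nrm_eq0.
have /choice[Rz hRz] := Dx.
have uniq f u : A (f, u) -> Rz (u - z *: f) = f.
  move=> Af; have h := hRz (u - z *: f); apply/subr0_eq/nrm_eq0/eqP.
  have := sa_bound z (sa_sub h Af); set w := Rz _.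
  have -> : u - z *: f + z *: w - u - z *: (w - f) = 0.
    by apply: hdot_ext => v; rewrite !hdotE; ring.
  by rewrite nrm0 => h1; rewrite eq_le nrm_ge0 andbT -(ler_pM2l zp) mulr0.
exists Rz; split=> //; split=> [a x y|].
  have := uniq _ _ (sa_lin a (hRz x) (hRz y)) => <-; congr Rz.
  by apply: hdot_ext => v; rewrite !hdotE; ring.
exists `|Im z|^-1 => [|x]; first by rewrite invr_ge0 normr_ge0.
by rewrite ler_pdivlMl//; have := sa_bound z (hRz x); rewrite addrK.
Qed.

End Theory.
End SelfAdjoint.

(** * Commutation with square roots *)

Section Commutation.
Context {R : realType} {H : hilbertType R}.
Implicit Types (A : oprel H H) (C : H -> H).

Definition commutes C A := forall f u, A (f, u) -> A (C f, C u).

Lemma commutes_comp C A : commutes C A -> commutes C (opcomp A A).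
Proof. by move=> cCA f u [v /= Afv Avu]; exists (C v); apply: cCA. Qed.

Lemma resolvent_commutes C A z Rz : bounded_linear C -> is_resolvent A z Rz ->
  (forall h, C (Rz h) = Rz (C h)) -> commutes C A.
Proof.
move=> bC [_ hR uR] cCR f u Afu; have := hR (C (u - z *: f)).
by rewrite -cCR (uR _ _ Afu) (blB bC) (blZ bC) subrK.
Qed.

Section PositiveContraction.
Variables Y C : H -> H.
Hypotheses (bY : bounded_linear Y) (bC : bounded_linear C).
Hypothesis Y_sym : forall h k, hdot (Y h) k = hdot h (Y k).
Hypothesis Y_ge0 : forall h, 0 <= Re (hdot (Y h) h).
Hypothesis Y_le1 : forall h, nrm (Y h) <= nrm h.
Hypothesis CYY : forall h, C (Y (Y h)) = Y (Y (C h)).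

Let Y_sqr_le h : nrm (Y h) ^+ 2 <= Re (hdot (Y h) h).
Proof.
have := Y_ge0 (h - Y h); rewrite (blB bY) !(hdotE, ReD, ReN) (Y_sym (Y h) h) -!nrm_sqr.
have h1 : Re (hdot (Y (Y h)) (Y h)) <= nrm (Y h) ^+ 2.
  by rewrite (le_trans (Re_hdot_le _ _))// expr2 ler_wpM2r ?nrm_ge0.
by lra.
Qed.

Let Z h := h - Y h.

(* [|Z h|^2 + |Y h|^2 <= |h|^2], so the squares of [|Y (Z^n h)|] sum up to at
   most [|h|^2] and cannot stay away from 0. *)
Let YZ_small h (e : R) : 0 < e -> exists n, nrm (Y (iter n Z h)) < e.
Proof.
move=> e0; apply: contrapT => /forallNP hn.
have hge n : e ^+ 2 <= nrm (Y (iter n Z h)) ^+ 2.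
  rewrite ler_sqr ?nnegrE ?nrm_ge0 ?(ltW e0)//.
  by rewrite leNgt; apply/negP/hn.
have step n : nrm (iter n Z h) ^+ 2 <= nrm h ^+ 2 - n%:R * e ^+ 2.
  elim: n => [|n IH]; first by rewrite mul0r subr0.
  rewrite iterS {1}/Z nrmB_sqr Re_hdotC.
  have := Y_sqr_le (iter n Z h); have := hge n.
  by rewrite -natr1 mulrDl mul1r; lra.
have e2 : 0 < e ^+ 2 by rewrite exprn_gt0.
have := archi_boundP (divr_ge0 (sqr_ge0 (nrm h)) (sqr_ge0 e)).
rewrite ltr_pdivrMr// => hlt; have := step (Num.bound (nrm h ^+ 2 / e ^+ 2)).
by have := sqr_ge0 (nrm (iter (Num.bound (nrm h ^+ 2 / e ^+ 2)) Z h)); lra.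
Qed.

Let X h := C (Y h) - Y (C h).

Let bX : bounded_linear X.
Proof. exact: bl_sub (bl_comp bC bY) (bl_comp bY bC). Qed.

Let XY h : X (Y h) = - Y (X h).
Proof.
by rewrite /X (blB bY) CYY opprB.
Qed.

(* [(1 + Y)^n] does not decrease norms, whereas [X (1 - Y)^n = (1 + Y)^n X]
   and [(1 - Y)^n Y] tends to 0. *)
Let XY0 h : X (Y h) = 0.
Proof.
have grow w : nrm w <= nrm (w + Y w).
  rewrite -ler_sqr ?nnegrE ?nrm_ge0// nrmD_sqr Re_hdotC.
  by have := Y_ge0 w; have := sqr_ge0 (nrm (Y w)); lra.
have XZ w : X (Z w) = X w + Y (X w) by rewrite /Z (blB bX) XY opprK.
have YZ n : Y (iter n Z h) = iter n Z (Y h).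
  by elim: n => //= n IH; rewrite -IH {1}/Z (blB bY).
have XZn n w : nrm (X w) <= nrm (X (iter n Z w)).
  by elim: n => //= n IH; rewrite (le_trans IH)// XZ.
have [_ [c c0 hc]] := bX.
apply/nrm_eq0/eqP; rewrite eq_le nrm_ge0 andbT.
apply: (@le0_of_eps _ _ c) => e e0; have [n hn] := YZ_small h e0.
rewrite (le_trans (XZn n _))// -YZ (le_trans (hc _))//.
by rewrite ler_wpM2l// ltW.
Qed.

(** The commutator [X] of [C] and [Y] anticommutes with [Y], as [C] commutes
    with [Y^2]; positivity of [Y] then forces [X = 0]. *)
Lemma sqrt_commutes_bounded h : C (Y h) = Y (C h).
Proof.
move: h; apply: (bl_eq_dense (bl_comp bC bY) (bl_comp bY bC)) => v hv.
have Yv : Y v = 0.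
  apply/nrm_eq0/eqP; rewrite -sqrf_eq0 nrm_sqr Y_sym hdotC.
  by rewrite (hv _ (subr0_eq (XY0 (Y v)))) conjc0.
have YCv : Y (C v) = 0.
  apply/nrm_eq0/eqP; rewrite -sqrf_eq0 nrm_sqr Y_sym -CYY.
  by rewrite Yv (bl0 bY) (bl0 bC) hdot0r.
by apply/nrm_eq0/eqP; rewrite -sqrf_eq0 nrm_sqr hv// Yv YCv (bl0 bC).
Qed.

End PositiveContraction.

Section SquareRoot.
Variables (A : oprel H H) (C : H -> H).
Hypotheses (sA : selfadjoint A) (nA : nonnegative A).
Hypotheses (bC : bounded_linear C) (cC : commutes C (opcomp A A)).
Variables (Rp Rm : H -> H).
Hypotheses (hRp : is_resolvent A 'i%C Rp) (hRm : is_resolvent A (- 'i%C) Rm).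

(* [Q = (1 + A^2)^-1] and [Y = A (1 + A^2)^-1]. *)
Let Q h := Rp (Rm h).
Let Y h := Rm h + 'i%C *: Q h.

Let bRp : bounded_linear Rp. Proof. by case: hRp. Qed.
Let bRm : bounded_linear Rm. Proof. by case: hRm. Qed.
Let bQ : bounded_linear Q. Proof. exact: bl_comp. Qed.
Let bY : bounded_linear Y. Proof. exact: bl_add bRm (bl_scale _ bQ). Qed.

Let ii : 'i%C * 'i%C = -1 :> R[i]. Proof. by rewrite -expr2 sqr_i. Qed.

Let AQ h : A (Q h, Y h). Proof. by case: hRp => _ hR _; exact: hR. Qed.

Let AY h : A (Y h, h - Q h).
Proof.
have [_ hR _] := hRm; have := sa_add sA (hR h) (sa_scale sA 'i%C (AQ h)).
by congr (A (_, _)); apply: hdot_ext => v; rewrite /Y !hdotE; ring: ii.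
Qed.

Let QY_unique h p y : A (p, y) -> A (y, h - p) -> p = Q h /\ y = Y h.
Proof.
move=> Ap Ay; have [_ _ uR] := hRm; have [_ _ uR'] := hRp.
have e1 : Rm h = y - 'i%C *: p.
  rewrite -(uR _ _ (sa_sub sA Ay (sa_scale sA 'i%C Ap))); congr Rm.
  by apply: hdot_ext => v; rewrite !hdotE; ring: ii.
have e2 : p = Q h by rewrite /Q e1 (uR' _ _ Ap).
by split=> //; rewrite /Y -e2 e1 subrK.
Qed.

Let QC h : C (Q h) = Q (C h).
Proof.
have /cC[y /= h1 h2] : opcomp A A (Q h, h - Q h) by exists (Y h); [exact: AQ|exact: AY].
by have [] := @QY_unique (C h) (C (Q h)) y h1; rewrite // -(blB bC).
Qed.

Let YY h : Y (Y h) = Q h - Q (Q h).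
Proof.
by have [_ ->] := QY_unique (AY (Q h)) (sa_sub sA (AQ h) (AQ (Q h))).
Qed.

Let Y_sym h k : hdot (Y h) k = hdot h (Y k).
Proof.
rewrite -[k in LHS](subrK (Q k)) hdotDr.
by rewrite (sa_sym sA (AQ h) (AQ k)) -(sa_sym sA (AY h) (AY k)) hdotBl subrK.
Qed.

Let Y_ge0 h : 0 <= Re (hdot (Y h) h).
Proof.
have := nA (AQ h); have := nA (AY h); rewrite !lecE /= => /andP[_ h1] /andP[_ h2].
rewrite -[h in X in _ <= Re (hdot _ X)](subrK (Q h)) hdotDr ReD Re_hdotC.
exact: addr_ge0.
Qed.

Let Y_le1 h : nrm (Y h) <= nrm h.
Proof.
rewrite -ler_sqr ?nnegrE ?nrm_ge0// -[h in X in _ <= X](subrK (Q h)) [X in _ <= X]nrmD_sqr.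
rewrite (sa_sym sA (AY h) (AQ h)) -nrm_sqr.
have := sqr_ge0 (nrm (h - Q h)); have := sqr_ge0 (nrm (Q h)).
by have := sqr_ge0 (nrm (Y h)); lra.
Qed.

Lemma sqrt_commutes_resolvent : commutes C A.
Proof.
apply: (resolvent_commutes bC hRm) => h.
have CY k : C (Y k) = Y (C k).
  apply: (sqrt_commutes_bounded bY bC Y_sym Y_ge0 Y_le1) => l.
  by rewrite !YY (blB bC) !QC.
have RmE k : Rm k = Y k - 'i%C *: Q k by rewrite addrK.
by rewrite !RmE (blB bC) (blZ bC) QC CY.
Qed.

End SquareRoot.

(** The square of the bounded positive operator [Y = A (1 + A^2)^-1] is
    [Q - Q^2] with [Q = (1 + A^2)^-1], so everything that commutes with [A^2]
    commutes with [Y^2], hence with [Y] and with [(A + i)^-1 = Y - i Q]. *)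
Lemma sqrt_commutes A C : selfadjoint A -> nonnegative A ->
  bounded_linear C -> commutes C (opcomp A A) -> commutes C A.
Proof.
move=> sA nA bC cC.
have i0 : Im ('i%C : R[i]) != 0 by rewrite oner_neq0.
have i1 : Im (- 'i%C : R[i]) != 0 by rewrite oppr_eq0 oner_neq0.
have [Rp hRp] := resolvent_exists sA i0; have [Rm hRm] := resolvent_exists sA i1.
exact: sqrt_commutes_resolvent hRp hRm.
Qed.
End Commutation.

(** * The polar decomposition of a self-adjoint operator *)

Section PolarDecomposition.
Context {R : realType} {H : hilbertType R}.
Variables (H0 M B : oprel H H) (S : {linear H -> H}).
Hypotheses (sH : selfadjoint H0) (hM : is_abs H0 M) (hB : is_sqrt M B).
Hypothesis hS : is_sgn H0 M S.

Let sM : selfadjoint M. Proof. by case: hM. Qed.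
Let nM : nonnegative M. Proof. by case: hM. Qed.
Let MM : opcomp M M = opcomp H0 H0.
Proof. by case: hM => _ _ ->; case: sH => _ _ ->. Qed.
Let sB : selfadjoint B. Proof. by case: hB. Qed.
Let nB : nonnegative B. Proof. by case: hB. Qed.
Let BB : opcomp B B = M. Proof. by case: hB. Qed.

Lemma sgn_bounded : bounded_linear S.
Proof. by case: hS => cS _ _; exact: bounded_of_continuous. Qed.
Let bS := sgn_bounded.

Lemma sgn_abs f u : H0 (f, u) -> exists2 v, M (f, v) & u = S v.
Proof. by case: hS => _ -> _ [v]; exists v. Qed.

Let H0M f v : M (f, v) -> H0 (f, S v).
Proof. by case: hS => _ -> _ ?; exists v. Qed.

Let S_ker f : M (f, 0) -> S f = 0.
Proof. by move=> /H0M; rewrite linear0; case: hS => _ _; apply. Qed.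

Let SH0 : commutes S H0.
Proof.
have i0 : Im ('i%C : R[i]) != 0 by rewrite oner_neq0.
have [R0 hR0] := resolvent_exists sH i0; have [bR0 hR uR] := hR0.
have cR0 : commutes R0 H0.
  by apply: (resolvent_commutes bR0 hR0).
have cRM : commutes R0 M.
  by apply: sqrt_commutes; rewrite ?MM//; exact: commutes_comp.
apply: (resolvent_commutes bS hR0).
apply: (bl_eq_dense (bl_comp bS bR0) (bl_comp bR0 bS)) => v hv.
have kv : M (v, 0).
  apply: (sa_ran_dense sM) => f u Mfu; apply: hv.
  have h1 := H0M Mfu; have h2 := H0M (cRM _ _ Mfu).
  exact: (sa_fun sH h2 (cR0 _ _ h1)).
have kR : M (R0 v, 0) by have := cRM _ _ kv; rewrite (bl0 bR0).
by apply/nrm_eq0/eqP; rewrite -sqrf_eq0 nrm_sqr hv// !S_ker// (bl0 bR0).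
Qed.

Let SM : commutes S M.
Proof.
by apply: sqrt_commutes => //; rewrite MM; exact: commutes_comp.
Qed.

(** Commutation descends through square roots three times: the resolvent of
    [H0] commutes with [M^2 = H0^2], hence with [M]; so it commutes with [S],
    as [S M = H0] and [S] vanishes on the kernel of [M]; then [S] commutes with
    [M^2], hence with [M = B^2], hence with [B]. *)
Lemma sgn_commutes : commutes S B.
Proof. by apply: sqrt_commutes => //; rewrite BB. Qed.

(** [S - S^*] maps the domain of [M] into the kernel of [M], because
    [M S = S M = H0] and [M S^* = H0^* = H0]; and both [S] and [S^*] vanish on
    that kernel. *)
Lemma sgn_sym x y : hdot (S x) y = hdot x (S y).
Proof.
have [S' bS' hS'] := adjoint_exists bS.
suff SE : S =1 S' by rewrite hS' SE.
apply: (bl_eq_dense bS bS') => v hv.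
apply: (sa_dom_dense sM) => f u Mf; apply: hv.
have S'ker w : M (w, 0) -> S' w = 0.
  move=> Mw; have kS' : M (S' w, 0).
    apply: (sa_ran_dense sM) => g t Mg; rewrite hdotC -hS' (hdotC (S t)) conjcK.
    by rewrite (sa_sym sH (H0M Mg) (H0M Mw)) linear0 hdot0r.
  by apply/nrm_eq0/eqP; rewrite -sqrf_eq0 nrm_sqr -hS' S_ker// hdot0r.
have MS' : M (S' f, S u).
  apply: (sa_adj sM) => g t Mg; rewrite hdotC -hS' (hdotC (S t)) conjcK.
  exact: (sa_sym sH (H0M Mg) (H0M Mf)).
have := sa_sub sM (SM Mf) MS'; rewrite subrr => kw.
apply/subr0_eq/nrm_eq0/eqP; rewrite -sqrf_eq0 nrm_sqr hdotBl -hS' (S_ker kw).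
by rewrite hdot0r subr0 hdotC hS' S'ker// hdot0l conjc0.
Qed.

(** [S^2 - 1] maps [M g], for [g] in the domain of [M^2], into the kernel of [M];
    as [S] is symmetric and vanishes on that kernel, the image is orthogonal to
    itself. Such [g] suffice by density. *)
Lemma sgn_sgn f v : M (f, v) -> S (S v) = v.
Proof.
have step g w x : M (g, w) -> M (w, x) -> S (S w) = w.
  move=> Mg Mw; have [y /= H0g H0y] : opcomp H0 H0 (g, x).
    by rewrite -MM; exists w.
  have [z Mz xE] := sgn_abs H0y.
  have yE := sa_fun sH H0g (H0M Mg).
  rewrite yE in Mz; have zE := sa_fun sM Mz (SM Mw).
  have := sa_sub sM (SM (SM Mw)) Mw; rewrite -zE -xE subrr => kw.
  apply/subr0_eq/nrm_eq0/eqP; rewrite -sqrf_eq0 nrm_sqr hdotBl sgn_sym (S_ker kw).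
  by rewrite (sa_sym sM Mg kw) !hdot0r subr0.
have i0 : Im ('i%C : R[i]) != 0 by rewrite oner_neq0.
have [Rz [bRz hR uR]] := resolvent_exists sM i0.
pose T h := h + 'i%C *: Rz h.
have bT : bounded_linear T by exact: bl_add (@bl_id _ _) (bl_scale _ bRz).
have ST : (fun h => S (S (T h))) =1 T.
  apply: (bl_eq_dense (bl_comp bS (bl_comp bS bT)) bT) => w hw.
  apply: (sa_dom_dense sM) => h u Mh; apply: hw.
  by apply: step (hR h) _; apply: (sa_add sM Mh); apply: (sa_scale sM); exact: hR.
move=> Mf; have := ST (v - 'i%C *: f).
by rewrite /T (uR _ _ Mf) subrK.
Qed.

(** The form that defines form sums extends that of [H0]: commuting [S] past
    [B] gives [B S B f = S M f = H0 f]. *)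
Lemma form_sgn f u b g c : H0 (f, u) -> B (f, b) -> B (g, c) ->
  hdot (S b) c = hdot u g.
Proof.
move=> /sgn_abs[v Mf ->] Bf Bg; move: Mf; rewrite -BB => -[b' /= Bb' Bv].
by rewrite (sa_fun sB Bf Bb') (sa_sym sB (sgn_commutes Bv) Bg).
Qed.

End PolarDecomposition.

(** * Compact maps and the Fredholm alternative *)

Section Compact.
Context {R : realType}.
Implicit Types H K L : hilbertType R.
Variable U : set_system nat.
Hypotheses (uU : UltraFilter U) (tailU : forall N, U [set n | (N <= n)%N]).

(** Testing compactness along one fixed ultrafilter replaces the successive
    extraction of subsequences. *)
Definition compact_map H K (T : H -> K) := forall x : nat -> H,
  (exists c, forall n, nrm (x n) <= c) ->
  exists y, forall e : R, 0 < e -> U [set n | nrm (T (x n) - y) < e].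

Lemma ultra_exists (P : set nat) N : U P -> exists2 n, (N <= n)%N & P n.
Proof.
by move=> UP; have [n [/= Nn Pn]] := filter_ex (filterI (tailU N) UP); exists n.
Qed.

Lemma compact_comp_l H K L (S : K -> L) (T : H -> K) :
  bounded_linear S -> compact_map T -> compact_map (fun x => S (T x)).
Proof.
move=> bS cT x /cT[y hy]; exists (S y) => e e0.
have [_ [c c0 hc]] := bS; have c1 : 0 < c + 1 by lra.
apply: filterS (hy _ (divr_gt0 e0 c1)) => n /=; rewrite ltr_pdivlMr// => h.
rewrite -(blB bS) (le_lt_trans (hc _))//; apply: le_lt_trans h.
by rewrite mulrC ler_wpM2l ?nrm_ge0// lerDl.
Qed.

Lemma compact_comp_r H K L (S : K -> L) (T : H -> K) :
  compact_map S -> bounded_linear T -> compact_map (fun x => S (T x)).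
Proof.
move=> cS [_ [c c0 hc]] x [d hd]; apply: cS; exists (c * d) => n.
by rewrite (le_trans (hc _))// ler_wpM2l.
Qed.

Lemma compact_lim H K (T : H -> K) :
  (forall e : R, 0 < e -> exists2 S : H -> K, compact_map S &
     forall x, nrm (T x - S x) <= e * nrm x) -> compact_map T.
Proof.
move=> hT x [c hc]; have c0 : 0 <= c := le_trans (nrm_ge0 _) (hc 0).
have c1 : 0 < c + 1 by lra.
have near_pt e : 0 < e -> exists y, U [set n | nrm (T (x n) - y) < e].
  move=> e0; have e2 : 0 < e / 2 by lra.
  have [S cS hS] := hT _ (divr_gt0 e2 c1).
  have [|y hy] := cS x; first by exists c.
  exists y; apply: filterS (hy _ e2) => n /= h.
  have := nrm_triangle (S (x n)) (T (x n)) y.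
  have : nrm (T (x n) - S (x n)) <= e / 2; last by lra.
  rewrite (le_trans (hS _))// mulrAC ler_pdivrMr//.
  by apply: ler_wpM2l; [exact: ltW|have := hc n; lra].
have /choice[y hy] : forall k : nat, exists y,
    U [set n | nrm (T (x n) - y) < k.+1%:R^-1].
  by move=> k; apply: near_pt; rewrite invr_gt0.
have dist p q : nrm (y p - y q) < p.+1%:R^-1 + q.+1%:R^-1.
  have [n [/= h1 h2]] := filter_ex (filterI (hy p) (hy q)).
  apply: (le_lt_trans (nrm_triangle (T (x n)) _ _)).
  by rewrite (nrmBC (y p)) ltrD.
have [|l yl] := @cauchy_cvgs _ _ y.
  move=> e e0; have [N hN] := invS_lt (divr_gt0 e0 (ltr0n R 2)).
  exists N => p q /hN hp /hN hq; apply: (lt_trans (dist p q)).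
  by rewrite [e]splitr ltrD.
exists l => e e0; have e2 : 0 < e / 2 by lra.
have [N hN] := invS_lt e2; have [N' hN'] := yl _ e2.
have hp := hN (maxn N N') (leq_maxl _ _); have hq := hN' (maxn N N') (leq_maxr _ _).
apply: filterS (hy (maxn N N')) => n /= h.
apply: (le_lt_trans (nrm_triangle (y (maxn N N')) _ _)).
by rewrite [e]splitr ltrD// (lt_trans h).
Qed.

Lemma compact_bounded H K (T : H -> K) :
  (forall a x y, T (a *: x + y) = a *: T x + T y) -> compact_map T ->
  bounded_linear T.
Proof.
move=> TP cT; split=> //; apply: contrapT => hno.
have T0 : T 0 = 0 by rewrite -[0 in LHS](addNr 0) -scaleN1r TP scaleN1r addNr.
have /choice[x hx] : forall n : nat, exists x, nrm x = 1 /\ n%:R < nrm (T x).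
  move=> n; apply: contrapT => hn; apply: hno; exists n%:R => [|x]; first exact: ler0n.
  have [->|/eqP x0] := eqVneq x 0; first by rewrite T0 !nrm0 mulr0.
  have np := nrm_gt0 x0; rewrite leNgt; apply/negP => hlt; apply: hn.
  exists ((nrm x)^-1%:C *: x).
  rewrite -[in T _](addr0 (_ *: x)) TP T0 addr0 !nrmZr gtr0_norm ?invr_gt0//.
  by rewrite mulVf ?gt_eqF// mulrC ltr_pdivlMr.
have [|y hy] := cT x; first by exists 1 => n; case: (hx n) => ->.
have [n hn /= h] := ultra_exists (Num.bound (nrm y + 1)) (hy _ ltr01).
have [_ h1] := hx n; have h2 := archi_boundP (addr_ge0 (nrm_ge0 y) ler01).
have h3 : (Num.bound (nrm y + 1))%:R <= n%:R :> R by rewrite ler_nat.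
by have := nrmD (T (x n) - y) y; rewrite subrK; lra.
Qed.

Section Fredholm.
Context {H : hilbertType R} {T : H -> H}.
Hypotheses (bT : bounded_linear T) (cT : compact_map T).
Hypothesis injT : forall x, x + T x = 0 -> x = 0.
Let V x := x + T x.

Let bV : bounded_linear V. Proof. exact: bl_add (@bl_id _ _) bT. Qed.

Let V_below : exists2 c : R, 0 < c & forall x, c * nrm x <= nrm (V x).
Proof.
apply: contrapT => hno.
have /choice[x hx] : forall n : nat, exists x, nrm x = 1 /\ nrm (V x) < n.+1%:R^-1.
  move=> n; apply: contrapT => hn; apply: hno; exists n.+1%:R^-1 => [|x].
    by rewrite invr_gt0.
  have [->|/eqP x0] := eqVneq x 0; first by rewrite nrm0 mulr0 nrm_ge0.
  have np := nrm_gt0 x0; rewrite leNgt; apply/negP => hlt; apply: hn.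
  exists ((nrm x)^-1%:C *: x); rewrite (blZ bV) !nrmZr gtr0_norm ?invr_gt0//.
  by rewrite mulVf ?gt_eqF// mulrC ltr_pdivrMr.
have x1 n : nrm (x n) = 1 by case: (hx n).
have [|y hy] := cT (x := x); first by exists 1 => n; rewrite x1.
have [_ [d d0 hd]] := bV.
have close e : 0 < e -> exists n, nrm (V (x n)) < e /\ nrm (x n + y) < 2 * e.
  move=> e0; have [N hN] := invS_lt e0.
  have [n Nn hn] := ultra_exists N (hy _ e0); exists n.
  have h1 : nrm (V (x n)) < e by case: (hx n) => _ h; exact: lt_trans h (hN _ Nn).
  split=> //; have -> : x n + y = V (x n) - (T (x n) - y) by rewrite opprB addrA addrAC addrK.
  by have := nrmD (V (x n)) (- (T (x n) - y)); rewrite nrmN; move: hn => /=; lra.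
have Vy : V y = 0.
  apply/nrm_eq0/eqP; rewrite eq_le nrm_ge0 andbT.
  apply: (@le0_of_eps _ _ (2 * d + 1)) => e /close[n [h1 h2]].
  have -> : V y = V (x n + y) - V (x n) by rewrite (blD bV) addrAC subrr add0r.
  have := nrmD (V (x n + y)) (- V (x n)); rewrite nrmN.
  have := hd (x n + y); have : d * nrm (x n + y) <= d * (2 * e) by rewrite ler_wpM2l// ltW.
  by lra.
have [|n [_]] := close 4^-1; first by rewrite invr_gt0.
by rewrite (injT Vy) addr0 x1; lra.
Qed.

Let Y n : set H := [set y | exists x, y = iter n V x].

Let Y_lin n a e f : Y n e -> Y n f -> Y n (a *: e + f).
Proof.
move=> [x ->] [y ->]; exists (a *: x + y).
by elim: n => //= n <-; rewrite (blD bV) (blZ bV).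
Qed.

Let Y_closed n s l : (forall k, Y n (s k)) -> cvgs s l -> Y n l.
Proof.
have [c c0 hc] := V_below.
elim: n s l => [|n IH] s l; first by move=> _ _; exists l.
move=> /choice[x hx] sl; pose t k := iter n V (x k).
have [|m tm] := @cauchy_cvgs _ _ t.
  move=> e e0; have [N hN] := cvgs_cauchy sl (mulr_gt0 c0 e0).
  exists N => p q Np Nq; have := hN _ _ Np Nq; rewrite !hx /= -(blB bV).
  by move=> /(le_lt_trans (hc _)); rewrite ltr_pM2l.
have [|w mw] := IH t m _ tm; first by move=> k; exists (x k).
exists w => /=; rewrite -mw; apply: (cvgs_unique sl).
by rewrite (_ : s = fun k => V (t k)); [exact: bl_cvgs|apply/funext => k; rewrite hx].
Qed.

Let Y_decr m n y : (n <= m)%N -> Y m y -> Y n y.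
Proof.
by move=> /subnKC <- [x ->]; exists (iter (m - n) V x); rewrite iterD.
Qed.

Let iter_inj n x y : iter n V x = iter n V y -> x = y.
Proof.
elim: n x y => //= n IH x y h; apply: IH; apply/subr0_eq/injT.
by rewrite -/(V _) (blB bV) h subrr.
Qed.

(* Otherwise the ranges of the powers of [V] would decrease strictly, and unit
   vectors [e n] of the n-th range orthogonal to the next one would have images
   [T (e n)] at mutual distance at least 1. *)
Let V_surj x : exists y, x = V y.
Proof.
apply: contrapT => hx.
have /choice[e he] : forall n, exists e,
    [/\ Y n e, nrm e = 1 & forall d, Y n.+1 d -> hdot d e = 0].
  move=> n; have [|||p Yp hp] := @closed_projection _ _ (Y n.+1) (iter n V x).
  - by exists 0; elim: n.+1 => //= k <-; rewrite (bl0 bV).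
  - exact: Y_lin.
  - exact: Y_closed.
  pose w := iter n V x - p; have w0 : w <> 0.
    move=> /subr0_eq w0; move: Yp; rewrite -w0 => -[y]; rewrite iterSr.
    by move=> /iter_inj h; apply: hx; exists y.
  have np := nrm_gt0 w0; exists ((nrm w)^-1%:C *: w); split.
  - have Yw : Y n w.
      rewrite /w addrC -scaleN1r; apply: Y_lin; last by exists x.
      exact: Y_decr Yp.
    rewrite -[_ *: w]addr0; apply: Y_lin => //.
    by rewrite -[0](addNr w) -scaleN1r; exact: Y_lin.
  - by rewrite nrmZr gtr0_norm ?invr_gt0// mulVf ?gt_eqF.
  - by move=> d /hp h; rewrite hdotZr hdotC h conjc0 mulr0.
have [|y hy] := cT (x := e); first by exists 1 => n; case: (he n) => _ ->.
have h2 := hy 2^-1; have [|n _ hn] := ultra_exists 0 (h2 _); first by rewrite invr_gt0.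
have [|m nm hm] := ultra_exists n.+1 (h2 _); first by rewrite invr_gt0.
have [Yn en orth] := he n; have [Ym _ _] := he m.
pose d := V (e n) - V (e m) + e m.
have Yd : Y n.+1 d.
  rewrite /d -(blB bV) -[V _]scale1r; apply: Y_lin; last exact: Y_decr Ym.
  have [z ->] : Y n (e n - e m).
    rewrite addrC -scaleN1r; apply: Y_lin => //; apply: Y_decr Ym; exact: ltnW.
  by exists z.
have := nrm_triangle y (T (e n)) (T (e m)); rewrite (nrmBC y).
have -> : T (e n) - T (e m) = d - e n.
  by apply: hdot_ext => v; rewrite /d /V !hdotE; ring.
have : 1 <= nrm (d - e n).
  rewrite -ler_sqr ?nnegrE ?ler01 ?nrm_ge0// nrmB_sqr orth// en expr1n.
  by have := sqr_ge0 (nrm d) => /=; lra.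
by move: hn hm => /=; lra.
Qed.

(** Compactness makes an injective [1 + T] bounded below, so that the ranges of
    its powers are closed; surjectivity is then the argument of Riesz on
    decreasing ranges. *)
Lemma fredholm_alternative : exists2 W : H -> H, bounded_linear W &
  (forall x, W x + T (W x) = x) /\ (forall x, W (x + T x) = x).
Proof.
have [c c0 hc] := V_below; have /choice[W hW] := V_surj.
have WK x : W (V x) = x.
  by apply/subr0_eq/injT; rewrite -/(V _) (blB bV) -hW subrr.
exists W; last by split=> // x; rewrite [RHS]hW.
split=> [a x y|].
  by rewrite {1}[x]hW {1}[y]hW -(blZ bV) -(blD bV) WK.
exists c^-1 => [|x]; first by rewrite invr_ge0 ltW.
by rewrite ler_pdivlMl// (le_trans (hc _))// -hW.
Qed.

End Fredholm.
End Compact.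

(** * The rigging operator *)

Section Rigging.
Context {R : realType} {H K : hilbertType R}.
Implicit Types (L : hilbertType R) (G : oprel H K).

Lemma nbhs_nrm L (x : L) (V : set L) : nbhs x V ->
  exists2 e : R, 0 < e & forall y, nrm (y - x) < e -> V y.
Proof.
move=> /nbhs_ballP[e /= e0 hV].
have eE : e = (Re e)%:C by rewrite RRe_real// gtr0_real.
exists (Re e) => [|y hy]; first by rewrite -ltcR -eE.
by apply: hV; rewrite -ball_normE /ball_ /= eE normE ltcR nrmBC.
Qed.

Lemma nrm_nbhs L (x : L) (e : R) : 0 < e -> nbhs x [set y | nrm (y - x) < e].
Proof.
move=> e0; apply/nbhs_ballP; exists e%:C; first by rewrite /= ltcR.
by move=> y; rewrite -ball_normE /ball_ /= normE ltcR nrmBC.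
Qed.

Lemma closed_cvgs G (f : nat -> H) (u : nat -> K) l m :
  closed G -> (forall n, G (f n, u n)) -> cvgs f l -> cvgs u m -> G (l, m).
Proof.
move=> cG hG fl um; apply: cG => V /= [[V1 V2] /= [/nbhs_nrm[e e0 h1]]].
move=> /nbhs_nrm[e' e'0 h2] hV.
have [N hN] := fl _ e0; have [N' hN'] := um _ e'0.
exists (f (maxn N N'), u (maxn N N')); split; first exact: hG.
by apply: hV; split=> /=; [apply/h1/hN/leq_maxl|apply/h2/hN'/leq_maxr].
Qed.

Lemma closure_graph (D : oprel K K) (T : K -> K) : bounded_linear T ->
  D `<=` graph T ->
  (forall k (e : R), 0 < e -> exists k', D (k', T k') /\ nrm (k' - k) < e) ->
  closure D = graph T.
Proof.
move=> bT DT Dd; have [_ [c c0 hT]] := bT; apply/seteqP; split=> -[k w].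
  move=> hc; rewrite /graph /=; apply/subr0_eq/nrm_eq0/eqP.
  rewrite eq_le nrm_ge0 andbT; apply: (@le0_of_eps _ _ (1 + c)) => e e0.
  have [|[k' w'] [/DT]] :=
      hc ([set y | nrm (y - k) < e] `*` [set y | nrm (y - w) < e]).
    by exists ([set y | nrm (y - k) < e], [set y | nrm (y - w) < e]) => //=;
      split; exact: nrm_nbhs.
  rewrite /graph /= => -> [/= b1 b2]; apply: (le_trans (nrm_triangle (T k') _ _)).
  rewrite mulrDl mul1r lerD//; first by rewrite nrmBC ltW.
  by rewrite -(blB bT) (le_trans (hT _))// ler_wpM2l// ltW.
rewrite {1}/graph /= => -> V [[V1 V2] /= [/nbhs_nrm[e e0 h1]]].
move=> /nbhs_nrm[e' e'0 h2] hV; have c1 : 0 < c + 1 by lra.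
have [|k' [Dk']] := Dd k (Num.min e (e' / (c + 1))); first by rewrite lt_min e0 divr_gt0.
rewrite lt_min ltr_pdivlMr// => /andP[k1 k2].
exists (k', T k'); split => //; apply: hV; split=> /=; first exact: h1.
apply: h2; rewrite -(blB bT) (le_lt_trans (hT _))// (le_lt_trans _ k2)//.
by rewrite mulrC ler_wpM2l ?nrm_ge0// lerDl.
Qed.

Variable F : oprel H K.
Hypothesis rF : rigging F.

Lemma rig_lin a f g u v : F (f, u) -> F (g, v) -> F (a *: f + g, a *: u + v).
Proof. by case: rF => -[[_ h _] _] _ _ _; exact: h. Qed.

Lemma rig_zero : F (0, 0). Proof. by case: rF => -[[]]. Qed.

Lemma rig_fun f u v : F (f, u) -> F (f, v) -> u = v.
Proof.
move=> Fu Fv; have := rig_lin (-1) Fu Fv; rewrite !scaleN1r addNr.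
by case: rF => -[[_ _ h] _] _ _ _ /h; rewrite addrC => /subr0_eq.
Qed.

(** The adjoint of a closed operator is densely defined: project [(0, v)]
    onto the graph. *)
Lemma adj_dense_orth v : (forall k h, adj F (k, h) -> hdot k v = 0) -> v = 0.
Proof.
move=> hv; pose d (p q : H * K) := hdot p.1 q.1 + hdot p.2 q.2.
have d_ge p : Re (d p p) = nrm p.1 ^+ 2 + nrm p.2 ^+ 2.
  by rewrite /d ReD !nrm_sqr.
have [||||||[f0 u0] F0 hp] := @orthogonal_projection R (H * K)%type d _ _ _ F (0, v).
- by move=> a x y z; rewrite /d /= !hdotE; ring.
- by move=> x y; rewrite /d rmorphD /= -!hdotC.
- by move=> x; rewrite d_ge addr_ge0// sqr_ge0.
- exact: rig_zero.
- by move=> a [e1 e2] [f1 f2]; exact: rig_lin.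
- move=> s Fs sc.
  have bnd (p : H * K) e : 0 < e -> Re (d p p) < e ^+ 2 -> nrm p.1 < e /\ nrm p.2 < e.
    move=> e0; rewrite d_ge => h.
    by split; rewrite -ltr_sqr ?nnegrE ?nrm_ge0 ?(ltW e0)//;
       apply: le_lt_trans h; rewrite ?lerDl ?lerDr sqr_ge0.
  have [|l1 s1] := @cauchy_cvgs _ _ (fun n => (s n).1).
    move=> e e0; have [N hN] := sc _ (exprn_gt0 2 e0); exists N => m n Nm Nn.
    by case: (bnd (s m - s n) e e0 (hN _ _ Nm Nn)).
  have [|l2 s2] := @cauchy_cvgs _ _ (fun n => (s n).2).
    move=> e e0; have [N hN] := sc _ (exprn_gt0 2 e0); exists N => m n Nm Nn.
    by case: (bnd (s m - s n) e e0 (hN _ _ Nm Nn)).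
  exists (l1, l2).
    case: rF => -[_ cF] _ _ _; apply: (closed_cvgs cF _ s1 s2) => n.
    by rewrite -surjective_pairing.
  move=> e e0; have e2 : 0 < e / 2 by lra.
  have q0 : 0 < Num.sqrt (e / 2) by rewrite sqrtr_gt0.
  have [N hN] := s1 _ q0; have [N' hN'] := s2 _ q0; exists (maxn N N') => n.
  rewrite geq_max => /andP[/hN a1 /hN' a2]; rewrite d_ge /= [e]splitr.
  by rewrite -[e / 2]sqr_sqrtr ?(ltW e2)// ltrD// ltr_sqr ?nnegrE ?nrm_ge0 ?sqrtr_ge0.
have F0' : adj F (v - u0, f0).
  move=> f u Ffu /=; have := hp _ Ffu; rewrite /d /= sub0r hdotNl => /eqP.
  by rewrite addrC subr_eq0 => /eqP h; rewrite hdotC h -hdotC.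
have h1 := hv _ _ F0'; have := hp _ F0; rewrite /d /= sub0r hdotNl => /eqP.
rewrite addrC subr_eq0 => /eqP h2.
have : nrm (v - u0) ^+ 2 + nrm f0 ^+ 2 = 0.
  by rewrite !nrm_sqr -ReD hdotBr h1 h2 sub0r addNr.
move=> /eqP; rewrite paddr_eq0 ?sqr_ge0// !sqrf_eq0.
move=> /andP[/eqP/nrm_eq0/subr0_eq vE /eqP/nrm_eq0 fE].
by move: F0; rewrite -vE fE => Fv; exact: rig_fun Fv rig_zero.
Qed.

Lemma adj_dense k (e : R) : 0 < e ->
  exists k' h, adj F (k', h) /\ nrm (k' - k) < e.
Proof.
move: k e; apply: (@dense_subspace _ _
  [set k | forall e : R, 0 < e -> exists k' h, adj F (k', h) /\ nrm (k' - k) < e]).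
- move=> e e0; exists 0, 0; split; last by rewrite subrr nrm0.
  by move=> f u _; rewrite /= !hdot0r.
- move=> a x y hx hy e e0; have e2 : 0 < e / 2 by lra.
  have a0 : 0 <= Re `|a| by rewrite -ler0c RRe_real ?normr_ge0// normr_real.
  have a1 : 0 < Re `|a| + 1 by lra.
  have [k1 [h1 [A1 n1]]] := hx _ (divr_gt0 e2 a1).
  have [k2 [h2 [A2 n2]]] := hy _ e2.
  exists (a *: k1 + k2), (a *: h1 + h2); split.
    by move=> f u Ffu; rewrite /= !hdotDr !hdotZr (A1 _ _ Ffu) (A2 _ _ Ffu).
  have -> : a *: k1 + k2 - (a *: x + y) = a *: (k1 - x) + (k2 - y).
    by apply: hdot_ext => v; rewrite !hdotE; ring.
  rewrite (le_lt_trans (nrmD _ _))// [e]splitr ler_ltD// nrmZ.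
  move: n1; rewrite ltr_pdivlMr// => /ltW; apply: le_trans.
  by rewrite mulrC ler_wpM2l ?nrm_ge0// lerDl.
- move=> x l hx xl e e0; have e2 : 0 < e / 2 by lra.
  have [N hN] := xl _ e2; have [k' [h [A n]]] := hx N _ e2; exists k', h; split=> //.
  apply: (le_lt_trans (nrm_triangle (x N) _ _)).
  by rewrite [e]splitr ltrD// hN.
- move=> v hv; apply: adj_dense_orth => k h Akh; apply: hv => e e0.
  by exists k, h; rewrite subrr nrm0.
Qed.

Lemma appE f u : F (f, u) -> app F f = u.
Proof. by move=> Ff; apply: (rig_fun _ Ff); rewrite /app; case: xgetP => [_ -> //|/(_ u)]. Qed.

End Rigging.

(** * Sandwiched resolvents of form perturbations *)

Section Perturbation.
Context {R : realType} {H K : hilbertType R}.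
Variables (F : oprel H K) (H0 M B : oprel H H) (S : {linear H -> H}).
Hypotheses (rF : rigging F) (sH : selfadjoint H0) (hM : is_abs H0 M).
Hypotheses (hB : is_sqrt M B) (hS : is_sgn H0 M S).
Hypothesis cF : relatively_compact F B.
Variable U : set_system nat.
Hypotheses (uU : UltraFilter U) (tailU : forall N, U [set n | (N <= n)%N]).

Let sB : selfadjoint B. Proof. by case: hB. Qed.
Let BB : opcomp B B = M. Proof. by case: hB. Qed.
Let bS : bounded_linear S. Proof. exact: sgn_bounded hS. Qed.

Lemma sqrt_appE f b : B (f, b) -> app B f = b.
Proof.
by move=> Bf; apply: (sa_fun sB _ Bf); rewrite /app; case: xgetP => [_ -> //|/(_ b)].
Qed.

Lemma sqrt_app f : dom B f -> B (f, app B f).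
Proof. by move=> [b Bf]; rewrite (sqrt_appE Bf). Qed.

Lemma rig_app f : dom B f -> F (f, app F f).
Proof. by case: cF => BF _ /BF[u Fu]; rewrite (appE rF Fu). Qed.

Lemma app_lin a f g : dom B f -> dom B g ->
  [/\ dom B (a *: f + g), app B (a *: f + g) = a *: app B f + app B g
    & app F (a *: f + g) = a *: app F f + app F g].
Proof.
move=> Bf Bg; have h := sa_lin sB a (sqrt_app Bf) (sqrt_app Bg); split.
- by exists (a *: app B f + app B g).
- exact: sqrt_appE.
- by apply: (appE rF); apply: (rig_lin rF); exact: rig_app.
Qed.

(** The relation behind [F (A - z)^-1 F^*], for [A] the form sum of [H0] and
    [<J F f, F g>]. Reading [F^* k] as the functional [<k, F g>] on the form
    domain makes the relation meaningful for all [k], and a change of [J] only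
    shifts [k]. *)
Definition form_resolvent (J : K -> K) (z : R[i]) : oprel K K :=
  [set p | exists f, [/\ dom B f, p.2 = app F f & forall g, dom B g ->
    hdot (S (app B f)) (app B g) + hdot (J (app F f)) (app F g) - z * hdot f g
    = hdot p.1 (app F g)]].

Lemma form_resolvent_shift J1 J2 z k w : form_resolvent J1 z (k, w) ->
  form_resolvent J2 z (k + (J2 w - J1 w), w).
Proof.
move=> [f [/= Bf -> h]]; exists f; split=> //= g Bg.
by rewrite !hdotE -h//; ring.
Qed.

Definition hdot_symmetric (J : K -> K) := forall x y, hdot (J x) y = hdot x (J y).

Let Im_sym (L : hilbertType R) (T : L -> L) x :
  (forall x y, hdot (T x) y = hdot x (T y)) -> Im (hdot (T x) x) = 0.
Proof.
move=> hT; have := hT x x; rewrite (hdotC (T x) x).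
by case: (hdot (T x) x) => a b /= [] ; lra.
Qed.

Lemma form_resolvent_lin J z a k w k' w' : bounded_linear J ->
  form_resolvent J z (k, w) -> form_resolvent J z (k', w') ->
  form_resolvent J z (a *: k + k', a *: w + w').
Proof.
move=> bJ [f [/= Bf -> h]] [f' [/= Bf' -> h']].
have [Bd dB dF] := app_lin a Bf Bf'; exists (a *: f + f'); split=> //= g Bg.
rewrite dB dF (blD bS) (blZ bS) (blD bJ) (blZ bJ) !hdotE -h// -h'//.
by ring.
Qed.

(** Non-real numbers are not eigenvalues, since the form is real. *)
Lemma form_resolvent0 J (z : R[i]) w : hdot_symmetric J -> Im z != 0 ->
  form_resolvent J z (0, w) -> w = 0.
Proof.
move=> sJ z0 [f [/= Bf -> h]]; suff f0 : f = 0.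
  by apply: (appE rF); rewrite f0; exact: rig_zero.
apply/nrm_eq0/eqP; rewrite -sqrf_eq0.
have := Im_sym (app B f) (sgn_sym sH hM hS); have := Im_sym (app F f) sJ.
have := h _ Bf; rewrite hdot0l hdotxx; case: (hdot (S _) _) => a1 b1.
case: (hdot (J _) _) => a2 b2; case: (z) z0 => c1 c2 /= c20 /eqP.
rewrite eq_complex /= => /andP[_ /eqP + ] h2 h1; rewrite h1 h2 mulr0 !add0r.
by move=> /eqP; rewrite oppr_eq0 mulf_eq0 (negPf c20).
Qed.

Lemma form_resolvent_unique J (z : R[i]) k w w' : bounded_linear J -> hdot_symmetric J ->
  Im z != 0 -> form_resolvent J z (k, w) -> form_resolvent J z (k, w') -> w = w'.
Proof.
move=> bJ sJ z0 h h'; have := form_resolvent_lin (-1) bJ h' h.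
by rewrite !scaleN1r addNr => /(form_resolvent0 sJ z0); rewrite addrC => /subr0_eq.
Qed.

Lemma compact_precompact (P : set K) (x : nat -> K) : precompact P ->
  (forall n, P (x n)) -> exists y, forall e : R, 0 < e -> U [set n | nrm (x n - y) < e].
Proof.
rewrite precompactE => cP Px.
have pU : ProperFilter (x @ U) by exact: fmap_proper_filter.
have xU : (x @ U) (closure P) by apply: (@filterE _ U) => n; exact/subset_closure/Px.
have [y [_ hy]] := cP _ pU xU.
exists y => e e0; have [//|UC] := in_ultra_setVsetC [set n | nrm (x n - y) < e] uU.
have xC : (x @ U) [set t | ~ nrm (t - y) < e] by [].
by have [t [/= tC /tC]] := hy _ _ xC (nrm_nbhs y e0).
Qed.

Let i0 : Im ('i%C : R[i]) != 0. Proof. by rewrite oner_neq0. Qed.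

(** [F (B - i)^-1] is compact, because [|(B - i) f|^2 = |B f|^2 + |f|^2]
    is the square of the graph norm of [B]. *)
Lemma rig_resolvent_compact RB : is_resolvent B 'i%C RB ->
  bounded_linear (fun h => app F (RB h)) /\ compact_map U (fun h => app F (RB h)).
Proof.
move=> [bR hR uR]; have dR h : dom B (RB h) by exists (h + 'i%C *: RB h).
have lin a x y : app F (RB (a *: x + y)) = a *: app F (RB x) + app F (RB y).
  by rewrite (blD bR) (blZ bR); case: (app_lin a (dR x) (dR y)).
suff cp : compact_map U (fun h => app F (RB h)) by split=> //; exact: (compact_bounded uU).
move=> x [c hc]; have c1 : 0 < c + 1 by have := nrm_ge0 (x 0); have := hc 0; lra.
pose t := (c + 1)^-1; have t0 : 0 < t by rewrite invr_gt0.
have [_ pF] := cF.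
have [|y hy] := @compact_precompact _ (fun n => app F (RB (t%:C *: x n))) pF.
  move=> n; set h := _ *: x n; exists (RB h), (h + 'i%C *: RB h).
  split; [exact: rig_app|exact: hR|].
  have -> : (1 : R[i]) = 1%:C by [].
  rewrite !normE -!rmorphXn -rmorphD /= lecR.
  have hE : nrm h <= 1.
    rewrite nrmZr gtr0_norm// mulrC ler_pdivrMr// mul1r.
    by have := hc n; lra.
  have <- : nrm h ^+ 2 = nrm (RB h) ^+ 2 + nrm (h + 'i%C *: RB h) ^+ 2.
    set b := h + _; have hb : h = b - 'i%C *: RB h by rewrite addrK.
    rewrite {1}hb nrmB_sqr nrm_i hdotZr.
    have := sa_Im sB (hR h); rewrite -/b; case: (hdot b _) => p q /= ->.
    by rewrite mul0r mulr0 oppr0 addr0 mulr0 subr0 addrC.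
  by rewrite -[1](expr1n _ 2) ler_sqr ?nnegrE ?nrm_ge0.
exists (t^-1%:C *: y) => e e0; apply: filterS (hy _ (mulr_gt0 t0 e0)) => n /=.
have -> : app F (RB (t%:C *: x n)) - y = t%:C *: (app F (RB (x n)) - t^-1%:C *: y).
  have -> : app F (RB (t%:C *: x n)) = t%:C *: app F (RB (x n)).
    have := lin t%:C (x n) 0; rewrite addr0 (bl0 bR) (appE rF (rig_zero rF)).
    by rewrite addr0.
  by rewrite scalerBr scalerA -rmorphM /= mulfV ?gt_eqF// scale1r.
by rewrite nrmZr gtr0_norm// ltr_pM2l.
Qed.

Lemma form_resolvent_free z k f u w : H0 (f, u) -> F (f, w) ->
  (forall g, dom B g -> hdot (u - z *: f) g = hdot k (app F g)) ->
  form_resolvent (fun=> 0) z (k, w).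
Proof.
move=> H0f Ff h; have [v] := sgn_abs hS H0f; rewrite -BB => -[b /= Bf _] _.
exists f; split; [by exists b|by rewrite (appE rF Ff)|move=> g Bg].
rewrite hdot0l addr0 (sqrt_appE Bf) -h// hdotBl hdotZl.
by rewrite (form_sgn sH hM hB hS H0f Bf (sqrt_app Bg)).
Qed.

(** With [C = (H0 - z)^-1], [RB = (B - i)^-1], [Phi = F RB] and [psi = Phi^* k],
    the form equation is solved by [f = (B + i) C psi], for which
    [(B - i) f = (B^2 + 1) C psi = S (psi + z C psi) + C psi]. *)
Lemma free_resolvent_exists (z : R[i]) : Im z != 0 -> exists N, [/\ bounded_linear N,
  compact_map U N & forall k, form_resolvent (fun=> 0) z (k, N k)].
Proof.
move=> z0; have [RB hRB] := resolvent_exists sB i0.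
have [C [bC hC uC]] := resolvent_exists sH z0.
have [bP cP] := rig_resolvent_compact hRB.
have [Q bQ hQ] := adjoint_exists bP; have [bR _ uR] := hRB.
pose T k := S (Q k + z *: C (Q k)) + C (Q k).
have bT : bounded_linear T.
  have bCQ := bl_comp bC bQ; apply: bl_add => //.
  exact: bl_comp bS (bl_add bQ (bl_scale z bCQ)).
exists (fun k => app F (RB (T k))); split=> [||k].
- exact: bl_comp bP bT.
- exact: (compact_comp_r cP bT).
set f' := C (Q k); have H0f' : H0 (f', Q k + z *: f') := hC (Q k).
have [v Mf' vE] := sgn_abs hS H0f'.
have TE : T k = v + f' by rewrite /T -/f' vE (sgn_sgn sH hM hS Mf').
move: Mf'; rewrite -BB => -[b /= Bf' Bb].
have Bf := sa_add sB Bb (sa_scale sB 'i%C Bf').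
have RT : RB (T k) = b + 'i%C *: f'.
  rewrite -(uR _ _ Bf) TE scalerDr scalerA -expr2 sqr_i scaleN1r.
  by rewrite opprD opprK addrA addrK.
rewrite RT; exists (b + 'i%C *: f'); split=> //=; first by exists (v + 'i%C *: b).
move=> g Bg; have Bg' := sqrt_app Bg; rewrite hdot0l addr0 (sqrt_appE Bf).
set c := app B g in Bg' *.
have -> : hdot k (app F g) = hdot (Q k) (c - 'i%C *: g) by rewrite -hQ (uR _ _ Bg').
rewrite (blD bS) (blZ bS) -vE !(hdotDl, hdotZl) hdotBr hdotZr.
rewrite (form_sgn sH hM hB hS H0f' Bf' Bg') (sa_sym sB Bf' Bg') !(hdotDl, hdotZl).
have -> : conjc 'i%C = - 'i%C :> R[i] by apply/eqP; rewrite eq_complex /= oppr0 !eqxx.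
by ring.
Qed.

Definition is_form_resolvent J z (T : K -> K) := [/\ bounded_linear T,
  compact_map U T & forall k w, form_resolvent J z (k, w) <-> w = T k].

(** The solution is [N (1 + J N)^-1], where [N] belongs to [J = 0]; injectivity
    of [1 + J N] is the absence of non-real eigenvalues. *)
Lemma form_resolvent_exists J (z : R[i]) : bounded_linear J -> hdot_symmetric J ->
  Im z != 0 -> exists T, is_form_resolvent J z T.
Proof.
move=> bJ sJ z0; have [N [bN cN hN]] := free_resolvent_exists z0.
have shift k : form_resolvent J z (k + J (N k), N k).
  by have := form_resolvent_shift J (hN k); rewrite subr0.
have [|W bW [W1 _]] := fredholm_alternative uU tailU (bl_comp bJ bN) (compact_comp_l uU bJ cN).
  move=> x hx; have := shift x; rewrite hx => /(form_resolvent0 sJ z0) Nx.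
  by move: hx; rewrite Nx (bl0 bJ) addr0.
exists (fun k => N (W k)); split.
- exact: bl_comp bN bW.
- exact: (compact_comp_r cN bW).
have hW k : form_resolvent J z (k, N (W k)) by rewrite -{1}[k]W1; exact: shift.
move=> k w; split=> [h|->//]; exact: form_resolvent_unique h (hW k).
Qed.

Let res_graph A z T : bounded_linear T ->
  (forall k w f h, adj F (k, h) -> A (f, h + z *: f) -> F (f, w) -> w = T k) ->
  (forall k h, adj F (k, h) -> exists2 f, A (f, h + z *: f) & F (f, T k)) ->
  sandwiched_resolvent F A z = graph T.
Proof.
move=> bT h1 h2; apply: closure_graph => // [[k w]|k e e0].
  by move=> [f [h /= Ak Af] Ff]; exact: h1 Ak Af Ff.
have [k' [h [Ak nk]]] := adj_dense rF k e0; exists k'; split=> //.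
by have [f Af Ff] := h2 _ _ Ak; exists f => //; exists h.
Qed.

Let adjE k h g : adj F (k, h) -> dom B g -> hdot h g = hdot k (app F g).
Proof. by move=> Ak Bg; rewrite hdotC -(Ak _ _ (rig_app Bg)) -hdotC. Qed.

(** On the domain of [F^*], which is dense, [form_resolvent] is
    [F (A - z)^-1 F^*] itself. *)
Lemma sandwiched_form_sum J z T V : is_form_resolvent J z T ->
  (forall f g, V f g = hdot (J (app F f)) (app F g)) ->
  sandwiched_resolvent F (form_sum B S V) z = graph T.
Proof.
move=> [bT _ hT] VE; apply: res_graph => // [k w f h Ak [/= Bf hf] Ff|k h Ak].
  apply/hT; exists f; split=> //=; first by rewrite (appE rF Ff).
  by move=> g Bg; rewrite -(adjE Ak Bg) -VE hf// hdotDl hdotZl addrK.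
have /hT[f [/= Bf -> hf]] : T k = T k by [].
exists f; last exact: rig_app; split=> //= g Bg.
by rewrite VE hdotDl hdotZl (adjE Ak Bg) -hf// subrK.
Qed.

Lemma sandwiched_free (z : R[i]) T : Im z != 0 -> is_form_resolvent (fun=> 0) z T ->
  sandwiched_resolvent F H0 z = graph T.
Proof.
move=> z0 [bT _ hT]; have [C [_ hC _]] := resolvent_exists sH z0.
have free k w f h : adj F (k, h) -> H0 (f, h + z *: f) -> F (f, w) -> w = T k.
  move=> Ak H0f Ff; apply/hT; apply: (form_resolvent_free H0f Ff) => g Bg.
  by rewrite addrK (adjE Ak Bg).
apply: res_graph => // k h Ak; exists (C h) => //.
have [v] := sgn_abs hS (hC h); rewrite -BB => -[b /= Bf _] _.
have Ff : F (C h, app F (C h)) by apply: rig_app; exists b.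
by rewrite -(free _ _ _ _ Ak (hC h) Ff).
Qed.

End Perturbation.

(** * Boundary values *)

Section Limits.
Context {R : realType}.
Implicit Types H K : hilbertType R.

Definition opnorm_lim H K (T : R -> H -> K) (L : H -> K) :=
  forall e : R, 0 < e ->
    \forall y \near (0 : R)^'+, forall x, nrm (T y x - L x) <= e * nrm x.

Lemma regular_lim H K (F : oprel H K) lam A (T : R -> K -> K) :
  (forall y : R, 0 < y -> sandwiched_resolvent F A (lam +i* y) = graph (T y)) ->
  regular_at F lam A -> exists2 L : K -> K, bounded_linear L & opnorm_lim T L.
Proof.
move=> hT [L cL hL]; exists L; first exact: bounded_of_continuous.
move=> e /hL hy; near=> y => x.
have y0 : 0 < y by near: y; exact: nbhs_right_gt.
have [S [_ hS]] : exists S : {linear K -> K}, [/\ continuous S,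
    sandwiched_resolvent F A (lam +i* y) = graph S
    & forall x, `|S x - L x| <= e%:C * `|x|] by near: y.
move=> /(_ x); rewrite hT// in hS *.
have -> : S x = T y x by have : graph (T y) (x, S x) by rewrite hS.
by rewrite !normE -rmorphM lecR.
Unshelve. all: by end_near. Qed.

Lemma lim_regular H K (F : oprel H K) lam A (T : R -> K -> K) (L : K -> K) :
  (forall y : R, 0 < y -> sandwiched_resolvent F A (lam +i* y) = graph (T y)) ->
  (forall y : R, 0 < y -> bounded_linear (T y)) ->
  bounded_linear L -> opnorm_lim T L -> regular_at F lam A.
Proof.
move=> hT bT bL TL; have [L' L'E] := linear_of_bounded bL.
exists L'; first by apply/continuous_of_bounded/(bl_ext L'E).
move=> e e0; near=> y; have y0 : 0 < y by near: y; exact: nbhs_right_gt.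
have [S SE] := linear_of_bounded (bT _ y0); exists S; split.
- exact/continuous_of_bounded/(bl_ext SE)/bT.
- by rewrite hT//; congr graph; apply/esym/funext.
- move=> x; rewrite SE L'E !normE -rmorphM lecR; move: x.
  by near: y; exact: TL.
Unshelve. all: by end_near. Qed.

Lemma compact_opnorm_lim U H K (T : R -> H -> K) L :
  UltraFilter U -> (forall N, U [set n | (N <= n)%N]) ->
  (forall y : R, 0 < y -> compact_map U (T y)) -> opnorm_lim T L -> compact_map U L.
Proof.
move=> uU tU cT TL; apply: compact_lim => // e e0.
have [y [y0 hy]] := filter_ex (filterI (nbhs_right_gt (0 : R)) (TL _ e0)).
by exists (T y) => [|x]; [exact: cT|rewrite nrmBC].
Qed.

(** If [N = T (1 + D N)] and [W] inverts [1 - D L], then [N] tends to [L W]: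
    for [k = (1 + D N) x] one has [k - W x = W D (T - L) k], so that [|k|] is
    controlled by [|x|]. *)
Lemma opnorm_lim_perturb K (N T : R -> K -> K) (D L W : K -> K) :
  bounded_linear D -> bounded_linear L -> bounded_linear W ->
  (forall y : R, 0 < y -> forall x, N y x = T y (x + D (N y x))) ->
  (forall x, W (x - D (L x)) = x) ->
  opnorm_lim T L -> opnorm_lim N (fun x => L (W x)).
Proof.
move=> bD bL bW NT WK TL e e0.
have [_ [d d0 hd]] := bD; have [_ [l l0 hl]] := bL; have [_ [w w0 hw]] := bW.
pose a := w * d; have a0 : 0 <= a by rewrite mulr_ge0.
pose b := (1 + l * a) * (2 * w).
have b0 : 0 <= b by rewrite mulr_ge0 ?addr_ge0 ?mulr_ge0.
pose del := Num.min (2 * (a + 1))^-1 (e / (b + 1)).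
have del0 : 0 < del by rewrite lt_min invr_gt0 divr_gt0//; lra.
have ha : a * del <= 2^-1.
  apply: (@le_trans _ _ (a * (2 * (a + 1))^-1)).
    by rewrite ler_wpM2l// ge_min lexx.
  by rewrite ler_pdivrMr; lra.
have hb : b * del <= e.
  apply: (@le_trans _ _ (b * (e / (b + 1)))).
    by rewrite ler_wpM2l// ge_min lexx orbT.
  by rewrite mulrA ler_pdivrMr; nra.
near=> y => x; have y0 : 0 < y by near: y; exact: nbhs_right_gt.
have Ty z : nrm (T y z - L z) <= del * nrm z by move: z; near: y; exact: TL.
pose k := x + D (N y x); pose E := T y k - L k.
have Nk : N y x = T y k by exact: NT.
have kE : k = W x + W (D E).
  rewrite -[LHS]WK -(blD bW); congr W.
  by rewrite /E (blB bD) -Nk addrA.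
have hE : nrm E <= del * nrm k := Ty k.
have hWD : nrm (W (D E)) <= a * del * nrm k.
  rewrite (le_trans (hw _))// -!mulrA ler_wpM2l// (le_trans (hd _))//.
  by rewrite ler_wpM2l.
have hk : nrm k <= 2 * w * nrm x.
  have := nrmD (W x) (W (D E)); rewrite -kE.
  have : a * del * nrm k <= 2^-1 * nrm k by rewrite ler_wpM2r ?nrm_ge0.
  by have := hw x; lra.
have -> : N y x - L (W x) = E + L (W (D E)).
  have -> : W (D E) = k - W x by rewrite kE addrAC subrr add0r.
  by rewrite (blB bL) /E Nk addrA subrK.
rewrite (le_trans (nrmD _ _))//.
have h1 : nrm (L (W (D E))) <= l * (a * del * nrm k).
  by rewrite (le_trans (hl _))// ler_wpM2l.
have h2 : (1 + l * a) * del * nrm k <= (1 + l * a) * del * (2 * w * nrm x).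
  by rewrite ler_wpM2l// mulr_ge0 ?(ltW del0)// addr_ge0 ?mulr_ge0.
have h3 : b * del * nrm x <= e * nrm x by rewrite ler_wpM2r ?nrm_ge0.
apply: le_trans h3; apply: (@le_trans _ _ ((1 + l * a) * del * nrm k)).
  by lra.
by apply: (le_trans h2); rewrite /b; lra.
Unshelve. all: by end_near. Qed.

(** [K0 = P J + J P - P J P] for the orthogonal projection [P] onto [x]. *)
Lemma finite_rank_interpolation K (J : {linear K -> K}) x :
  bounded_selfadjoint J -> exists K0 : {linear K -> K},
    [/\ bounded_selfadjoint K0, finite_rank K0 & K0 x = J x].
Proof.
move=> [cJ sJ].
have [a ca ax] : exists2 a : R[i], conjc a = a & x <> 0 -> hdot x x * a = 1.
  exists ((nrm x ^+ 2)^-1)%:C => [|x0]; first by rewrite conjc_real.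
  by rewrite hdotxx -rmorphM /= mulfV// sqrf_eq0 gt_eqF// nrm_gt0.
have [c cc cE] : exists2 c, conjc c = c & hdot (J x) x = c.
  by exists (hdot (J x) x) => //; rewrite -hdotC sJ.
pose k y := hdot y x *: (a *: J x) + hdot y (J x) *: (a *: x)
            - hdot y x *: ((a ^+ 2 * c) *: x).
have bk : bounded_linear k.
  by apply: bl_sub; [apply: bl_add|]; exact: bl_rank1.
have [K0 K0E] := linear_of_bounded bk; exists K0; split.
- split; first exact/continuous_of_bounded/(bl_ext K0E).
  move=> y z; rewrite !K0E /k !hdotE !rmorphM ?rmorphXn /= !ca cc.
  by rewrite -!hdotC; ring.
- exists 2, (fun i : 'I_2 => if i == 0 then J x else x) => _ [y _ <-].
  exists (fun i : 'I_2 => if i == 0 then hdot y x * a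
    else hdot y (J x) * a - hdot y x * (a ^+ 2 * c)).
  by rewrite !big_ord_recr big_ord0 /= add0r K0E /k !scalerA scalerBl addrA.
- rewrite K0E /k; have [->|/eqP x0] := eqVneq x 0.
    by rewrite !hdot0l !scale0r subr0 addr0 (linear0 J).
  rewrite !scalerA ax// scale1r -addrA -scalerBl expr2 !mulrA ax// mul1r.
  by rewrite -sJ cE [a * c]mulrC subrr scale0r addr0.
Qed.

Lemma scaled_symmetric K (r : R) (T : K -> K) :
  hdot_symmetric T -> hdot_symmetric (fun x => r%:C *: T x).
Proof. by move=> sT x y; rewrite hdotZl hdotZr conjc_real sT. Qed.

End Limits.

(** * Lines of resonant operators *)

Theorem corollary3p10 (R : realType) (H K : hilbertType R)
    (F : oprel H K) (H0 absH0 sqrtH0 : oprel H H) (sgnH0 : {linear H -> H})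
    (lam : R) :
  rigging F ->
  selfadjoint H0 ->
  is_abs H0 absH0 -> is_sqrt absH0 sqrtH0 -> is_sgn H0 absH0 sgnH0 ->
  relatively_compact F sqrtH0 ->
  ess_spectrum H0 lam%:C ->
  semi_regular F sqrtH0 sgnH0 lam ->
  resonant_at F lam H0 ->
  forall J : {linear K -> K}, bounded_selfadjoint J ->
    regular_direction F sqrtH0 sgnH0 lam (direction F J) ->
    exists K0 : {linear K -> K},
      [/\ bounded_selfadjoint K0, finite_rank K0
        & ~ regular_direction F sqrtH0 sgnH0 lam
              (fun f g => direction F J f g - direction F K0 f g)].
Proof.
move=> rF sH hM hB hS cF _ _ res J sJ [r reg].
have bJ : bounded_linear J by apply: bounded_of_continuous; case: sJ.
have [U [uU tU]] := ultraFilterLemma (@eventually_filter).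
have tailU N : U [set n | (N <= n)%N] by apply: tU; exact: nbhs_infty_ge.
have Imy (y : R) : 0 < y -> Im (lam +i* y) != 0 by move=> /gt_eqF /= ->.
have family J' : bounded_linear J' -> hdot_symmetric J' ->
    exists T : R -> K -> K, forall y : R, 0 < y ->
      is_form_resolvent F sqrtH0 sgnH0 U J' (lam +i* y) (T y).
  move=> bJ' sJ'; suff /choice[T hT] : forall y : R, exists T, 0 < y ->
      is_form_resolvent F sqrtH0 sgnH0 U J' (lam +i* y) T by exists T.
  move=> y; have [y0|] := pselect (0 < y); last by exists (fun=> 0).
  have [T hT] := form_resolvent_exists rF sH hM hB hS cF uU tailU bJ' sJ' (Imy _ y0).
  by exists T.
have z_b : bounded_linear (fun _ : K => 0 : K).
  split=> [a x y|]; first by rewrite scaler0 addr0.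
  by exists 0 => // x; rewrite nrm0 mul0r.
have z_s : hdot_symmetric (fun _ : K => 0 : K) by move=> x y; rewrite hdot0l hdot0r.
pose J1 x := r%:C *: J x; have bJ1 : bounded_linear J1 := bl_scale _ bJ.
have sJ1 : hdot_symmetric J1 by apply: scaled_symmetric; case: sJ.
have [N hN] := family _ z_b z_s; have [T hT] := family _ bJ1 sJ1.
have [L bL TL] : exists2 L : K -> K, bounded_linear L & opnorm_lim T L.
  apply: regular_lim reg => y /hT hTy; apply: (sandwiched_form_sum rF cF hTy).
  by move=> f g; rewrite /direction /J1 hdotZl.
have cL : compact_map U L.
  by apply: (compact_opnorm_lim uU tailU _ TL) => y /hT[].
(* [H0] is resonant, so [1 - r J T_(lam + i0)] is not injective. *)
have [u u0 uE] : exists2 u, u <> 0 & u = J1 (L u).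
  apply: contrapT => hu; apply: res.
  have [|||W bW [_ WK]] := @fredholm_alternative _ U uU tailU K (fun x => - J1 (L x)).
  - exact: bl_opp (bl_comp bJ1 bL).
  - exact: (compact_comp_l uU (bl_opp bJ1) cL).
  - move=> x /subr0_eq xE; apply: contrapT => x0; apply: hu.
    by exists x.
  apply: (@lim_regular _ H K F lam H0 N (fun x => L (W x))).
  - by move=> y y0; apply: (sandwiched_free rF sH hM hB hS cF (Imy _ y0)); exact: hN.
  - by move=> y /hN[].
  - exact: bl_comp bL bW.
  apply: (opnorm_lim_perturb bJ1 bL bW _ WK TL) => y y0 x.
  have [_ _ hNy] := hN _ y0; have [_ _ hTy] := hT _ y0.
  have /hNy/(form_resolvent_shift J1) : N y x = N y x by [].
  by rewrite subr0 => /hTy.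
have [K0 [sK0 fK0 K0E]] := finite_rank_interpolation (L u) sJ.
exists K0; split=> // -[s reg'].
have bK0 : bounded_linear K0 by apply: bounded_of_continuous; case: sK0.
pose J2 x := s%:C *: (J x - K0 x).
have bJ2 : bounded_linear J2 by apply: bl_scale; exact: bl_sub.
have sJ2 : hdot_symmetric J2.
  apply: scaled_symmetric => x y; rewrite hdotBl hdotBr.
  by case: sJ => _ ->; case: sK0 => _ ->.
have [T' hT'] := family _ bJ2 sJ2.
have [L' bL' TL'] : exists2 L' : K -> K, bounded_linear L' & opnorm_lim T' L'.
  apply: regular_lim reg' => y /hT' hTy; apply: (sandwiched_form_sum rF cF hTy).
  by move=> f g; rewrite /direction /J2 hdotZl hdotBl.
(* [K0] agrees with [J] on [L u], so [u + (J2 - J1) (T y u)] tends to 0,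
   whereas its image under [T' y] is [T y u]. *)
pose D x := J2 x - J1 x; have bD : bounded_linear D := bl_sub bJ2 bJ1.
have DLu : D (L u) = - u by rewrite /D /J2 K0E subrr scaler0 sub0r -uE.
have [_ [c c0 hc]] := bL'; have [_ [d d0 hd]] := bD.
have Lu0 : L u = 0.
  apply/nrm_eq0/eqP; rewrite eq_le nrm_ge0 andbT.
  apply: (@le0_of_eps _ _ (nrm u + (c + 1) * d * nrm u)) => e e0.
  have [y [y0 [hy hy']]] := filter_ex (filterI (nbhs_right_gt (0 : R))
    (filterI (TL _ e0) (TL' _ ltr01))).
  have [_ _ hTy] := hT _ y0; have [_ _ hTy'] := hT' _ y0.
  have TE : T y u = T' y (D (T y u - L u)).
    have /hTy/(form_resolvent_shift J2)/hTy' TyE : T y u = T y u by [].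
    by rewrite [LHS]TyE (blB bD) DLu opprK [in RHS]addrC.
  have hT'D : nrm (T y u) <= (c + 1) * d * nrm u * e.
    rewrite TE; set x := D _.
    have hx : nrm x <= d * (e * nrm u).
      by rewrite (le_trans (hd _))// ler_wpM2l.
    have : nrm (T' y x) <= (c + 1) * nrm x.
      have := nrm_triangle (L' x) (T' y x) 0; rewrite !subr0.
      by have := hy' x; have := hc x; lra.
    have : (c + 1) * nrm x <= (c + 1) * (d * (e * nrm u)) by rewrite ler_wpM2l ?addr_ge0.
    by lra.
  have := nrm_triangle (T y u) (L u) 0; rewrite !subr0 nrmBC.
  by have := hy u; lra.
by apply: u0; rewrite uE Lu0 (bl0 bJ1).
Qed.
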